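(* Termination of triangular affine integer loops is decidable.
   Context: A triangular affine integer loop is $\textbf{while } \phi \textbf{ do } \mathbf{x}\leftarrow A\mathbf{x}+\mathbf{a}$, where $d\ge1$, $A\in\mathbb{Z}^{d\times d}$ is triangular (all entries below, or all entries above, the main diagonal are zero), $\mathbf{x}$ is a vector of pairwise different variables $x_1,\dots,x_d$, $\mathbf{a}\in\mathbb{Z}^d$, and $\phi$ is a conjunction of inequalities $\alpha>0$ with $\alpha=\mathbf{c}^T\mathbf{x}+c$, $\mathbf{c}\in\mathbb{Q}^d$, $c\in\mathbb{Q}$. With $f(\mathbf{x})=A\mathbf{x}+\mathbf{a}$, the loop is non-terminating if there exists $\mathbf{c}\in\mathbb{Z}^d$ such that $\phi[\mathbf{x}/f^n(\mathbf{c})]$ holds for all $n\in\mathbb{N}$; otherwise it terminates. Decidability means there is an algorithm that, given $A,\mathbf{a},\phi$, decides whether the loop terminates. *)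

(* Defs.v *)
From mathcomp Require Import all_boot all_order all_algebra.

Set Implicit Arguments.
Unset Strict Implicit.
Unset Printing Implicit Defensive.

Import Order.TTheory GRing.Theory Num.Theory.

Local Open Scope ring_scope.

(* The total recursive functions nat^k -> nat: Kleene's schemes, minimization
   being restricted to functions that have a zero for every argument, so that
   the class consists of the total functions computable by an algorithm.
   Each scheme takes the defining equations of the function it constructs as
   hypotheses; these equations determine the function pointwise. *)
Inductive recursive : forall k : nat, (k.-tuple nat -> nat) -> Prop :=
| rec_zero k (h : k.-tuple nat -> nat) :
    (forall v, h v = 0%N) -> recursive h
| rec_succ (h : 1.-tuple nat -> nat) :
    (forall n : nat, h [tuple n] = n.+1) -> recursive h
| rec_proj k (i : 'I_k) (h : k.-tuple nat -> nat) :
    (forall v, h v = tnth v i) -> recursive h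
| rec_comp k m (g : m.-tuple nat -> nat) (f : 'I_m -> k.-tuple nat -> nat)
    (h : k.-tuple nat -> nat) :
    recursive g -> (forall i, recursive (f i)) ->
    (forall v, h v = g [tuple f i v | i < m]) -> recursive h
| rec_prim k (f : k.-tuple nat -> nat) (g : k.+2.-tuple nat -> nat)
    (h : k.+1.-tuple nat -> nat) :
    recursive f -> recursive g ->
    (forall v, h (cons_tuple 0%N v) = f v) ->
    (forall n v, h (cons_tuple n.+1 v) =
                 g (cons_tuple n (cons_tuple (h (cons_tuple n v)) v))) ->
    recursive h
| rec_mu k (g : k.+1.-tuple nat -> nat) (h : k.-tuple nat -> nat) :
    recursive g ->
    (forall v, g (cons_tuple (h v) v) = 0%N) ->
    (forall v n, (n < h v)%N -> g (cons_tuple n v) <> 0%N) ->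
    recursive h.

(* The property P of the instances satisfying D is decidable, an instance x
   being presented to the algorithm as the number enc x. *)
Definition computably_decidable (T : Type) (enc : T -> nat) (D P : T -> Prop) :=
  exists h : 1.-tuple nat -> nat, recursive h /\
    forall x, D x -> (P x -> h [tuple enc x] = 1%N) /\
                     (~ P x -> h [tuple enc x] = 0%N).

(* A pair (c, c0) in the guard stands for the inequality c^T x + c0 > 0. *)
Record affine_loop := AffineLoop {
  dim : nat;
  update_mx : 'M[int]_dim;
  update_vec : 'cV[int]_dim;
  guard : seq ('cV[rat]_dim * rat) }.

Definition triangular (d : nat) (A : 'M[int]_d) : Prop :=
  (forall i j : 'I_d, (j < i)%N -> A i j = 0) \/
  (forall i j : 'I_d, (i < j)%N -> A i j = 0).

Definition triangular_loop (L : affine_loop) : Prop :=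
  (1 <= dim L)%N /\ triangular (update_mx L).

Definition update (L : affine_loop) (x : 'cV[int]_(dim L)) : 'cV[int]_(dim L) :=
  update_mx L *m x + update_vec L.

Definition guard_holds (L : affine_loop) (x : 'cV[int]_(dim L)) : Prop :=
  forall alpha, alpha \in guard L ->
    0 < (alpha.1^T *m map_mx (intr : int -> rat) x) 0 0 + alpha.2.

Definition nonterminating (L : affine_loop) : Prop :=
  exists c : 'cV[int]_(dim L), forall n : nat,
    guard_holds (iter n (@update L) c).

Definition terminates (L : affine_loop) : Prop := ~ nonterminating L.

Definition encode_int (z : int) : nat :=
  match z with Posz n => n.*2 | Negz n => n.*2.+1 end.

Definition encode_rat (q : rat) : nat :=
  CodeSeq.code [:: encode_int (numq q); encode_int (denq q)].

Definition encode_cv (T : Type) (enc : T -> nat) (d : nat) (v : 'cV[T]_d) : nat :=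
  CodeSeq.code [seq enc (v i 0) | i <- enum 'I_d].

Definition encode_mx (T : Type) (enc : T -> nat) (d : nat) (A : 'M[T]_d) : nat :=
  CodeSeq.code
    [seq CodeSeq.code [seq enc (A i j) | j <- enum 'I_d] | i <- enum 'I_d].

Definition encode_atom (d : nat) (alpha : 'cV[rat]_d * rat) : nat :=
  CodeSeq.code [:: encode_cv encode_rat alpha.1; encode_rat alpha.2].

Definition encode_loop (L : affine_loop) : nat :=
  CodeSeq.code [:: dim L;
                   encode_mx encode_int (update_mx L);
                   encode_cv encode_int (update_vec L);
                   CodeSeq.code [seq encode_atom alpha | alpha <- guard L]].

Lemma encode_int_inj : injective encode_int.
Proof.
have P (a b : nat) : a.*2 = b.*2.+1 -> False.
  by move/(congr1 odd); rewrite /= !odd_double.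
move=> [a|a] [b|b] //= e.
- by rewrite (double_inj e).
- by case: (P a b).
- by case: (P b a).
- by case: e => /double_inj ->.
Qed.

Lemma encode_rat_inj : injective encode_rat.
Proof.
move=> p q /(can_inj CodeSeq.codeK) [] /encode_int_inj en /encode_int_inj ed.
by rewrite -(divq_num_den p) -(divq_num_den q) en ed.
Qed.

Lemma encode_cv_inj (T : Type) (enc : T -> nat) (d : nat) :
  injective enc -> injective (@encode_cv T enc d).
Proof.
move=> inj u v /(can_inj CodeSeq.codeK) /eq_in_map e.
by apply/matrixP => i j; rewrite (ord1 j); apply/inj/e; rewrite mem_enum.
Qed.

Lemma encode_mx_inj (T : Type) (enc : T -> nat) (d : nat) :
  injective enc -> injective (@encode_mx T enc d).
Proof.
move=> inj A B /(can_inj CodeSeq.codeK) /eq_in_map e.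
apply/matrixP => i j; apply: inj.
have /(can_inj CodeSeq.codeK) /eq_in_map := e i (mem_enum _ i).
by apply; rewrite mem_enum.
Qed.

Lemma encode_loop_inj : injective encode_loop.
Proof.
move=> [d A a phi] [d' A' a' phi'] /(can_inj CodeSeq.codeK) /= [e].
subst d'; move=> /(encode_mx_inj encode_int_inj) -> /(encode_cv_inj encode_int_inj) ->.
move=> /(can_inj CodeSeq.codeK) /inj_map -> // -[u p] [v q].
by move=> /(can_inj CodeSeq.codeK) [] /(encode_cv_inj encode_rat_inj) -> /encode_rat_inj ->.
Qed.

(* Main.v *)
From mathcomp Require Import all_boot all_order all_algebra.
From mathcomp Require Import zify ring.
Require Import Defs.

(* A loop is non-terminating iff some integer point satisfies the guard from some
   time on.  Along the even, resp. odd, iterates, each guard expression is a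
   sequence u(n) annihilated by the product of the E - l, where E is the shift and
   l ranges over 1 and the squared non-zero diagonal entries (Cayley-Hamilton).
   Sorting the l increasingly, u is eventually positive iff the last non-vanishing
   entry of u(0), ((E - l_1) u)(0), ((E - l_2) (E - l_1) u)(0), ... is positive.
   These values are affine in the initial point, so non-termination is a sign
   condition on finitely many integral affine forms; if it has an integer
   solution, it has one below a computable bound.  For points below a given bound,
   the time after which the sign of u is constant is computable as well.  Hence it
   suffices to test the guard at two consecutive late times on all small points,
   which is a total recursive procedure. *)

Set Implicit Arguments.
Unset Strict Implicit.
Unset Printing Implicit Defensive.

Import Order.TTheory GRing.Theory Num.Theory.

(** * Recursive functions *)

(** Triangularity makes all eigenvalues integers, so dominance among the exponential terms is a
    comparison of integers. Applying the operators E - l one after the other replaces a closed form,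
    whose coefficients would be rational, by integer values at 0. It is enough that the guard holds
    from some time on, because a late iterate of an integer point is again an integer point. The
    obstacle is that the time after which a sign is constant depends on the initial point. Hence the
    search space is bounded first, by a number that depends on the loop alone, and the time is
    computed from that bound. To bound it, the sign of each affine form at a known solution, zero
    included, is prescribed to the small one; the eventual signs then agree. All bounds are crude,
    since only their computability matters. They are functions of the code of the loop, which is at
    least as large as its dimension, its entries and its number of inequalities. *)

(* Functions of k variables are written on sequences of length k, so that bound
   variables are read off by head and behead. *)
Definition computable (k : nat) (f : seq nat -> nat) :=
  recursive (fun v : k.-tuple nat => f v).

Lemma computable_proj k i : computable k (fun s => nth 0 s i).
Proof.
case: (ltnP i k) => [ltik | leki].
  by apply: (rec_proj (i := Ordinal ltik)) => v; rewrite (tnth_nth 0).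
by apply: rec_zero => v; rewrite nth_default ?size_tuple.
Qed.

Lemma computable_compose k (g : seq nat -> nat) (fs : seq (seq nat -> nat)) :
  computable (size fs) g ->
  (forall i, computable k (nth (fun=> 0) fs i)) ->
  computable k (fun s => g [seq f s | f <- fs]).
Proof.
move=> g_rec fs_rec.
apply: (rec_comp (f := fun i v => nth (fun=> 0) fs (val i) v) g_rec) => [i|v].
  exact: fs_rec.
congr g; apply: (@eq_from_nth _ 0) => [|i]; rewrite size_map ?size_tuple // => lti.
rewrite (nth_map (fun=> 0)) // (nth_map (Ordinal lti)) ?size_enum_ord //=.
by rewrite nth_enum_ord.
Qed.

(** Composition with the projections rebuilds the argument, and [rec_comp] asks for pointwise
    equality only; this stands in for functional extensionality. *)
Lemma computable_ext k (f g : seq nat -> nat) :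
  computable k f -> (forall s, size s = k -> f s = g s) -> computable k g.
Proof.
move=> f_rec eq_fg.
apply: (rec_comp (f := fun i v => tnth v i) f_rec) => [i|v]; first exact: rec_proj.
rewrite -eq_fg ?size_tuple //; congr f; congr tval.
by apply: eq_from_tnth => i; rewrite tnth_mktuple.
Qed.

Lemma computable_cons k (g f : seq nat -> nat) :
  computable k.+1 g -> computable k f -> computable k (fun s => g (f s :: s)).
Proof.
move=> g_rec f_rec.
pose fs := f :: mkseq (fun i s => nth 0 s i) k.
have size_fs : size fs = k.+1 by rewrite /= size_mkseq.
have := @computable_compose k g fs; rewrite size_fs => /(_ g_rec) comp_rec.
apply: computable_ext (comp_rec _) _ => [[|i]|s size_s] //=.
  case: (ltnP i k) => [ltik | leki].
    by rewrite nth_mkseq //; apply: computable_proj.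
  by rewrite nth_default ?size_mkseq //; apply: rec_zero.
congr (g (_ :: _)); rewrite -map_comp.
by rewrite -[RHS](mkseq_nth 0) size_s.
Qed.

Lemma computable_behead k (f : seq nat -> nat) :
  computable k f -> computable k.+1 (fun s => f (behead s)).
Proof.
move=> f_rec; pose fs := mkseq (fun i s => nth 0 s i.+1) k.
have := @computable_compose k.+1 f fs; rewrite size_mkseq => /(_ f_rec) comp_rec.
apply: computable_ext (comp_rec _) _ => [i|[//|a s] [size_s]].
  case: (ltnP i k) => [ltik | leki].
    by rewrite nth_mkseq //; apply: computable_proj.
  by rewrite nth_default ?size_mkseq //; apply: rec_zero.
by rewrite -map_comp -[in RHS](mkseq_nth 0 s) size_s.
Qed.

Lemma computable_behead2 k f :
  computable k f -> computable k.+2 (fun s => f (behead (behead s))).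
Proof. by move=> f_rec; apply: (computable_behead (computable_behead f_rec)). Qed.

Lemma computable_comp1 k (g : nat -> nat) f :
  computable 1 (fun s => g (head 0 s)) -> computable k f ->
  computable k (fun s => g (f s)).
Proof.
move=> g_rec f_rec; apply: (@computable_compose k _ [:: f] g_rec).
by case=> [|[|i]] //=; apply: rec_zero.
Qed.

Lemma computable_var0 k : computable k (fun s => head 0 s).
Proof. exact: computable_proj 0. Qed.

Lemma computable_var1 k : computable k (fun s => head 0 (behead s)).
Proof. by apply: computable_ext (computable_proj k 1) _ => -[|a [|b s]]. Qed.

Lemma computable_succ k f : computable k f -> computable k (fun s => (f s).+1).
Proof. by apply: computable_comp1; apply: rec_succ. Qed.

Lemma computable_const k c : computable k (fun=> c).
Proof.
elim: c => [|c IHc]; first exact: rec_zero.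
exact: computable_succ.
Qed.

Lemma computable_rec k (n x : seq nat -> nat) (step : seq nat -> nat -> nat -> nat) :
  computable k n -> computable k x ->
  computable k.+2 (fun s => step (behead (behead s)) (head 0 s) (head 0 (behead s))) ->
  computable k (fun s => nat_rect (fun=> nat) (x s) (step s) (n s)).
Proof.
move=> n_rec x_rec step_rec.
have base : computable k.+1
    (fun s => nat_rect (fun=> nat) (x (behead s)) (step (behead s)) (head 0 s)).
  exact: (rec_prim x_rec step_rec).
exact: (computable_cons base n_rec).
Qed.

Lemma computable_iter k (n x : seq nat -> nat) (step : seq nat -> nat -> nat) :
  computable k n -> computable k x ->
  computable k.+1 (fun s => step (behead s) (head 0 s)) ->
  computable k (fun s => iter (n s) (step s) (x s)).
Proof.
move=> n_rec x_rec step_rec.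
have step'_rec : computable k.+2
    (fun s => step (behead (behead s)) (head 0 (behead s))).
  exact: (computable_behead step_rec).
apply: computable_ext
  (computable_rec n_rec x_rec (step := fun s _ r => step s r) step'_rec) _ => s _.
by elim: (n s) => [|m /= ->].
Qed.

(** * Arithmetic, bounded quantifiers and search *)

Definition computable_pred k (p : seq nat -> bool) :=
  computable k (fun s => nat_of_bool (p s)).

Lemma computable_mu k (h : seq nat -> nat) (p : seq nat -> nat -> bool) :
  computable_pred k.+1 (fun s => ~~ p (behead s) (head 0 s)) ->
  (forall s, p s (h s)) -> (forall s n, p s n -> h s <= n) -> computable k h.
Proof.
move=> p_rec ph h_min; apply: (rec_mu p_rec) => [v|v n] /=; first by rewrite ph.
by case: (boolP (p v n)) => // /h_min; rewrite leqNgt => /negP.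
Qed.

Lemma computable_add k f g :
  computable k f -> computable k g -> computable k (fun s => f s + g s).
Proof.
move=> f_rec g_rec.
apply: computable_ext (computable_iter f_rec g_rec (step := fun=> succn) _) _ => [|s _].
  exact/computable_succ/computable_var0.
by rewrite iter_succn addnC.
Qed.

Lemma computable_mul k f g :
  computable k f -> computable k g -> computable k (fun s => f s * g s).
Proof.
move=> f_rec g_rec.
apply: computable_ext
  (computable_iter f_rec (computable_const k 0) (step := fun s => addn (g s)) _) _.
  exact/computable_add/computable_var0/computable_behead.
by move=> s _; rewrite iter_addn addn0 mulnC.
Qed.

Lemma computable_double k f : computable k f -> computable k (fun s => (f s).*2).
Proof.
move=> f_rec; apply: computable_ext (computable_add f_rec f_rec) _ => s _.
by rewrite addnn.
Qed.

Lemma computable_exp k f g :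
  computable k f -> computable k g -> computable k (fun s => f s ^ g s).
Proof.
move=> f_rec g_rec.
apply: computable_ext
  (computable_iter g_rec (computable_const k 1) (step := fun s => muln (f s)) _) _.
  exact/computable_mul/computable_var0/computable_behead.
by move=> s _; rewrite iter_muln muln1.
Qed.

Lemma computable_pred_nat k f : computable k f -> computable k (fun s => (f s).-1).
Proof.
move=> f_rec.
apply: computable_ext
  (computable_rec f_rec (computable_const k 0) (step := fun _ i _ => i) _) _.
  exact: computable_var0.
by move=> s _; case: (f s).
Qed.

Lemma computable_sub k f g :
  computable k f -> computable k g -> computable k (fun s => f s - g s).
Proof.
move=> f_rec g_rec.
apply: computable_ext (computable_iter g_rec f_rec (step := fun=> predn) _) _.
  exact/computable_pred_nat/computable_var0.
by move=> s _; rewrite iter_predn.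
Qed.

Lemma computable_fact k f : computable k f -> computable k (fun s => (f s)`!).
Proof.
move=> f_rec; apply: computable_ext
  (computable_rec f_rec (computable_const k 1) (step := fun _ i r => i.+1 * r) _) _.
  exact/computable_mul/computable_var1/computable_succ/computable_var0.
by move=> s _; elim: (f s) => //= n ->.
Qed.

Lemma computable_leq k f g :
  computable k f -> computable k g -> computable_pred k (fun s => f s <= g s).
Proof.
move=> f_rec g_rec; apply: computable_ext
  (computable_sub (computable_const k 1) (computable_sub f_rec g_rec)) _.
by move=> s _; rewrite -subn_eq0; case: (f s - g s) => [|[|n]].
Qed.

Lemma computable_neg k p : computable_pred k p -> computable_pred k (fun s => ~~ p s).
Proof.
move=> p_rec; apply: computable_ext (computable_sub (computable_const k 1) p_rec) _.
by move=> s _; case: (p s).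
Qed.

Lemma computable_and k p q :
  computable_pred k p -> computable_pred k q -> computable_pred k (fun s => p s && q s).
Proof.
move=> p_rec q_rec; apply: computable_ext (computable_mul p_rec q_rec) _.
by move=> s _; rewrite mulnb.
Qed.

Lemma computable_or k p q :
  computable_pred k p -> computable_pred k q -> computable_pred k (fun s => p s || q s).
Proof.
move=> p_rec q_rec.
apply: computable_ext (computable_neg (computable_and (computable_neg p_rec)
                                                      (computable_neg q_rec))) _.
by move=> s _; rewrite negb_and !negbK.
Qed.

Lemma computable_eqn k f g :
  computable k f -> computable k g -> computable_pred k (fun s => f s == g s).
Proof.
move=> f_rec g_rec.
apply: computable_ext (computable_and (computable_leq f_rec g_rec)
                                      (computable_leq g_rec f_rec)) _.
by move=> s _; rewrite eqn_leq.
Qed.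

Lemma computable_if k p f g :
  computable_pred k p -> computable k f -> computable k g ->
  computable k (fun s => if p s then f s else g s).
Proof.
move=> p_rec f_rec g_rec.
apply: computable_ext (computable_add (computable_mul p_rec f_rec)
                         (computable_mul (computable_neg p_rec) g_rec)) _.
by move=> s _; case: (p s); rewrite /= ?mul1n ?mul0n ?addn0.
Qed.

(** The step of a primitive recursion receives the counter and then the accumulator; this weakens a
    function of the counter and the parameters by the accumulator. *)
Lemma computable_insert k (g : seq nat -> nat) :
  computable k.+1 g -> computable k.+2 (fun s => g (head 0 s :: behead (behead s))).
Proof.
move=> g_rec.
pose fs : seq (seq nat -> nat) :=
  (fun s => head 0 s) :: mkseq (fun i s => nth 0 s i.+2) k.
have := @computable_compose k.+2 g fs; rewrite /= size_mkseq => /(_ g_rec) comp_rec.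
apply: computable_ext (comp_rec _) _ => [[|i]|[|a [|b s]] //= [size_s]].
- exact: computable_var0.
- case: (ltnP i k) => [ltik | leki] /=.
    by rewrite nth_mkseq //; apply: computable_proj.
  by rewrite nth_default ?size_mkseq //; apply: rec_zero.
by congr (g (_ :: _)); rewrite -map_comp -[in RHS](mkseq_nth 0 s) size_s.
Qed.

Lemma computable_sum k n (F : seq nat -> nat -> nat) :
  computable k n -> computable k.+1 (fun s => F (behead s) (head 0 s)) ->
  computable k (fun s => \sum_(i < n s) F s i).
Proof.
move=> n_rec F_rec.
have step_rec : computable k.+2 (fun s =>
    F (behead (behead s)) (head 0 s) + head 0 (behead s)).
  apply: computable_add; last exact: computable_var1.
  exact: (computable_insert F_rec).
apply: computable_ext (computable_rec n_rec (computable_const k 0)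
  (step := fun s i r => F s i + r) step_rec) _.
move=> s _; elim: (n s) => [|m IHm] /=; first by rewrite big_ord0.
by rewrite big_ord_recr /= addnC IHm.
Qed.

Lemma computable_forall k n (p : seq nat -> nat -> bool) :
  computable k n -> computable_pred k.+1 (fun s => p (behead s) (head 0 s)) ->
  computable_pred k (fun s => [forall i : 'I_(n s), p s i]).
Proof.
move=> n_rec p_rec.
have sum_rec := computable_sum n_rec (F := fun s i => ~~ p s i) (computable_neg p_rec).
apply: computable_ext (computable_eqn sum_rec (computable_const k 0)) _ => s _.
rewrite sum_nat_eq0; congr nat_of_bool; apply: eq_forallb => i /=.
by case: (p s i).
Qed.

Lemma computable_exists k n (p : seq nat -> nat -> bool) :
  computable k n -> computable_pred k.+1 (fun s => p (behead s) (head 0 s)) ->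
  computable_pred k (fun s => [exists i : 'I_(n s), p s i]).
Proof.
move=> n_rec p_rec.
have := computable_neg
  (computable_forall n_rec (p := fun s i => ~~ p s i) (computable_neg p_rec)).
move/computable_ext; apply => s _; rewrite negb_forall; congr nat_of_bool.
by apply: eq_existsb => i; rewrite negbK.
Qed.

Lemma computable_divn k f g :
  computable k f -> computable k g -> computable k (fun s => f s %/ g s).
Proof.
move=> f_rec g_rec.
(* The disjunct [g s == 0] stops the search at 0, the value of a division by 0. *)
apply: (@computable_mu k _ (fun s q => (g s == 0) || (f s < q.+1 * g s))) => [|s|s n].
- apply: computable_neg; apply: computable_or.
    exact: computable_eqn (computable_behead g_rec) (computable_const _ 0).
  apply: computable_leq; first exact/computable_succ/computable_behead.
  exact/computable_mul/computable_behead/g_rec/computable_succ/computable_var0.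
- by case: (posnP (g s)) => //= g_gt0; rewrite ltn_ceil.
case: (posnP (g s)) => [->|g_gt0 /=]; first by rewrite divn0.
by rewrite -ltn_divLR.
Qed.

Lemma computable_odd k f : computable k f -> computable_pred k (fun s => odd (f s)).
Proof.
move=> f_rec.
have half_rec := computable_divn f_rec (computable_const k 2).
apply: computable_ext
  (computable_sub f_rec (computable_mul half_rec (computable_const k 2))) _.
by move=> s _; rewrite {1}(divn_eq (f s) 2) modn2 addKn.
Qed.

(** For [m > 0] the valuation is the least [i] with [m %/ 2 ^ i] odd; for [m = 0] the search stops
    at [logn 2 0 = 0]. *)
Lemma computable_logn2 k f : computable k f -> computable k (fun s => logn 2 (f s)).
Proof.
move=> f_rec; pose p s i := (f s == 0) || odd (f s %/ 2 ^ i).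
have odd_logn m : 0 < m -> odd (m %/ 2 ^ logn 2 m).
  move=> m_gt0; apply/negPn/negP; rewrite -dvdn2 => /dvdnP[c eq_c].
  have : 2 ^ (logn 2 m).+1 %| m.
    by rewrite -[X in _ %| X](divnK (pfactor_dvdnn 2 m)) eq_c -mulnA -expnS dvdn_mull.
  by rewrite pfactor_dvdn // ltnn.
apply: (@computable_mu k _ p) => [|s|s n].
- apply: computable_neg; apply: computable_or.
    exact: computable_eqn (computable_behead f_rec) (computable_const _ 0).
  apply/computable_odd/computable_divn; first exact: computable_behead.
  exact: computable_exp (computable_const _ 2) (computable_var0 _).
- by rewrite /p; case: posnP => //= /odd_logn.
rewrite /p; case: posnP => [->|f_gt0 /=]; first by rewrite logn0.
apply: contraLR; rewrite -ltnNge => lt_n.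
have /divnK <- : 2 ^ n.+1 %| f s by rewrite pfactor_dvdn.
by rewrite expnS [2 * _]mulnC mulnA mulnAC mulnK ?expn_gt0 // oddM andbF.
Qed.

(** * Decoding sequences *)

Definition code_tail (m : nat) := ((m %/ 2 ^ logn 2 m).-1)./2.

(** The code of [a :: s] is [2 ^ a * (CodeSeq.code s).*2.+1]: the head is the 2-adic valuation, and
    the tail is read off the odd part. *)
Lemma code_tail_cons a s : code_tail (CodeSeq.code (a :: s)) = CodeSeq.code s.
Proof.
rewrite /code_tail /= lognM ?expn_gt0 // pfactorK // lognE /= dvdn2 /= odd_double /=.
by rewrite addn0 mulKn ?expn_gt0 //= doubleK.
Qed.

Definition getc (m i : nat) := nth 0 (CodeSeq.decode m) i.

(** Past the end of the list both sides are 0, because [code_tail 0 = 0] and [logn 2 0 = 0]. *)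
Lemma getcE m i : getc m i = logn 2 (iter i code_tail m).
Proof.
rewrite /getc -[in RHS](CodeSeq.decodeK m); elim: (CodeSeq.decode m) i => [|a s IHs] [|i].
- by rewrite /= logn0.
- rewrite nth_nil /= -[RHS]/(logn 2 (code_tail (iter i code_tail 0))).
  have -> : iter i code_tail 0 = 0 by elim: i => //= i ->; rewrite /code_tail div0n.
  by rewrite /code_tail div0n logn0.
- by rewrite /= lognM ?expn_gt0 // pfactorK // lognE /= dvdn2 /= odd_double addn0.
by rewrite iterSr code_tail_cons -IHs.
Qed.

Lemma getc_code s i : getc (CodeSeq.code s) i = nth 0 s i.
Proof. by rewrite /getc CodeSeq.codeK. Qed.

Lemma computable_getc k f g :
  computable k f -> computable k g -> computable k (fun s => getc (f s) (g s)).
Proof.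
move=> f_rec g_rec.
have tail_rec : computable k.+1 (fun s => code_tail (head 0 s)).
  have v_rec := computable_var0 k.+1.
  have q_rec := computable_divn v_rec
    (computable_exp (computable_const k.+1 2) (computable_logn2 v_rec)).
  apply: computable_ext
    (computable_divn (computable_pred_nat q_rec) (computable_const _ 2)) _.
  by move=> s _; rewrite divn2.
have it_rec := computable_iter g_rec f_rec (step := fun=> code_tail) tail_rec.
by apply: computable_ext (computable_logn2 it_rec) _ => s _; rewrite getcE.
Qed.

Lemma computable_mkseq k n (F : seq nat -> nat -> nat) :
  computable k n -> computable k.+1 (fun s => F (behead s) (head 0%N s)) ->
  computable k (fun s => CodeSeq.code (mkseq (F s) (n s))).
Proof.
move=> n_rec F_rec.
(* The code grows from the end of the list: step [i] prepends the entry of index [n s - i.+1]. *)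
pose step s i r := (2 ^ F s (n s - i.+1) * (r * 2).+1)%N.
have arg_rec : computable k.+2 (fun s => n (behead (behead s)) - (head 0 s).+1)%N.
  exact: computable_sub (computable_behead2 n_rec) (computable_succ (computable_var0 _)).
have F_rec' : computable k.+2
    (fun s => F (behead (behead s)) (n (behead (behead s)) - (head 0 s).+1)%N).
  have := computable_cons (computable_insert (computable_insert F_rec)) arg_rec.
  by [].
have step_rec : computable k.+2
    (fun s => step (behead (behead s)) (head 0%N s) (head 0%N (behead s))).
  apply: computable_mul; first exact: computable_exp (computable_const _ 2) F_rec'.
  exact/computable_succ/computable_mul/computable_const/computable_var1.
apply: computable_ext (computable_rec n_rec (computable_const k 0) step_rec) _ => s _.
suff rec_code m : (m <= n s)%N -> nat_rect (fun=> nat) 0%N (step s) m =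
    CodeSeq.code [seq F s i | i <- iota (n s - m) m].
  by rewrite (rec_code (n s)) // subnn.
elim: m => //= m IHm lt_m; rewrite IHm 1?ltnW // /step muln2.
by rewrite subnSK.
Qed.

(** * Integer-valued computable functions *)

Definition dec_int (m : nat) : int := if odd m then Negz m./2 else Posz m./2.

Lemma encode_intK : cancel encode_int dec_int.
Proof. by case=> n; rewrite /dec_int /= odd_double ?doubleK // uphalf_double. Qed.

Lemma dec_intK : cancel dec_int encode_int.
Proof.
by move=> n; rewrite /dec_int -[in RHS](odd_double_half n); case: odd.
Qed.

(** With differences of natural functions, sums and products need no case distinction on signs. *)
Definition computable_int k (f : seq nat -> int) :=
  exists p q, [/\ computable k p, computable k q &
    forall s, f s = (Posz (p s) - Posz (q s))%R].

Lemma computable_int_nat k f : computable k f -> computable_int k (fun s => Posz (f s)).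
Proof.
move=> f_rec; exists f, (fun=> 0); split=> //; first exact: computable_const.
by move=> s; rewrite subr0.
Qed.

Lemma computable_dec_int k f : computable k f -> computable_int k (fun s => dec_int (f s)).
Proof.
move=> f_rec; have half_rec := computable_divn f_rec (computable_const k 2).
exists (fun s => if odd (f s) then 0 else f s %/ 2).
exists (fun s => if odd (f s) then (f s %/ 2).+1 else 0); split=> [||s].
- exact: computable_if (computable_odd f_rec) (computable_const _ 0) half_rec.
- exact: computable_if (computable_odd f_rec) (computable_succ half_rec)
    (computable_const _ 0).
by rewrite /dec_int divn2; case: odd; rewrite ?subr0 // NegzE sub0r.
Qed.

Lemma computable_encode_int k f :
  computable_int k f -> computable k (fun s => encode_int (f s)).
Proof.
move=> [p [q [p_rec q_rec eq_f]]]; have two_rec := computable_const k 2.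
(* For [p s < q s] the value is [Negz (q s - p s).-1], whose code is [(q s - p s) * 2 - 1]. *)
have e_rec := computable_if (computable_leq q_rec p_rec)
  (computable_mul (computable_sub p_rec q_rec) two_rec)
  (computable_pred_nat (computable_mul (computable_sub q_rec p_rec) two_rec)).
apply: computable_ext e_rec _ => s _; rewrite eq_f.
case: leqP => [le_qp | lt_pq]; first by rewrite subzn //= muln2.
have -> : (Posz (p s) - Posz (q s))%R = Negz (q s - p s).-1 by rewrite NegzE; lia.
by rewrite /=; lia.
Qed.

Lemma computable_int_add k f g : computable_int k f -> computable_int k g ->
  computable_int k (fun s => (f s + g s)%R).
Proof.
move=> [p [q [p_rec q_rec eq_f]]] [p' [q' [p'_rec q'_rec eq_g]]].
exists (fun s => p s + p' s), (fun s => q s + q' s); split; try exact: computable_add.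
by move=> s; rewrite eq_f eq_g; lia.
Qed.

Lemma computable_int_mul k f g : computable_int k f -> computable_int k g ->
  computable_int k (fun s => (f s * g s)%R).
Proof.
move=> [p [q [p_rec q_rec eq_f]]] [p' [q' [p'_rec q'_rec eq_g]]].
exists (fun s => p s * p' s + q s * q' s), (fun s => p s * q' s + q s * p' s).
split; try by apply: computable_add; apply: computable_mul.
by move=> s; rewrite eq_f eq_g !PoszD !PoszM; ring.
Qed.

Lemma computable_int_sum k n (F : seq nat -> nat -> int) :
  computable k n -> computable_int k.+1 (fun s => F (behead s) (head 0 s)) ->
  computable_int k (fun s => (\sum_(i < n s) F s i)%R).
Proof.
move=> n_rec [p [q [p_rec q_rec eq_F]]].
exists (fun s => \sum_(i < n s) p (nat_of_ord i :: s)).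
exists (fun s => \sum_(i < n s) q (nat_of_ord i :: s)); split=> [||s].
- apply: (computable_sum (F := fun s i => p (i :: s))) => //.
  by apply: computable_ext p_rec _ => -[].
- apply: (computable_sum (F := fun s i => q (i :: s))) => //.
  by apply: computable_ext q_rec _ => -[].
rewrite -[Posz (\sum_(_ < _) p _)]natz -[Posz (\sum_(_ < _) q _)]natz !natr_sum -sumrB.
by apply: eq_bigr => i _; rewrite !natz -eq_F.
Qed.

Lemma computable_int_gt0 k f :
  computable_int k f -> computable_pred k (fun s => (0 < f s)%R).
Proof.
move=> [p [q [p_rec q_rec eq_f]]].
apply: computable_ext (computable_leq (computable_succ q_rec) p_rec) _ => s _.
by rewrite eq_f subr_gt0.
Qed.

Local Open Scope ring_scope.

(** * Small solutions of linear systems *)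

(** A finite type, so that its elements can index the unknowns of the next system. *)
Definition null_vec (I : finType) (a : I -> int) (S : nat) : finType :=
  {h : {ffun I -> 'I_S.+1} | \sum_i a i * (h i : nat)%:Z == 0}.

(** Every other term is at least [- K ^ 2], and [z i <= a i * z i]. *)
Lemma pos_coef_bound (I : finType) (a : I -> int) (b : int) (K : nat) (z : I -> nat) :
  (forall i, `|a i| <= K)%N -> (`|b| <= K)%N -> \sum_i a i * (z i)%:Z = b ->
  (forall j, a j < 0 -> (z j <= K)%N) ->
  forall i, 0 < a i -> (z i <= #|I| * K ^ 2 + K)%N.
Proof.
move=> a_le b_le sol neg_le i a_gt0.
have : - (#|I| * K ^ 2)%:Z <= \sum_(j | j != i) a j * (z j)%:Z.
  apply: (@le_trans _ _ (\sum_(j | j != i) - (K ^ 2)%:Z)).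
    rewrite sumr_const mulNrn lerN2 -mulr_natl natz PoszM.
    by apply: ler_wpM2r => //; rewrite lez_nat max_card.
  apply: ler_sum => j _; have := a_le j; have := neg_le j.
  case: (ltP (a j) 0) => [aj_lt0 /(_ isT) zj_le aj_le | aj_ge0 _ _].
    rewrite -[a j * _]opprK -mulNr lerN2 -mulnn PoszM ler_pM //; lia.
  by apply: (@le_trans _ _ 0); [rewrite oppr_le0 | rewrite mulr_ge0].
move: sol; rewrite (bigD1 i) //=; set r := \sum_(_ | _) _ => sol r_ge.
have : (z i)%:Z <= a i * (z i)%:Z by rewrite ler_peMl //; lia.
by lia.
Qed.

(* If some z i and z j with coefficients of opposite signs are both at least K,
   then |a j| e_i + |a i| e_j is a null vector below z and can be subtracted;
   otherwise all the positive or all the negative part of z is small, and then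
   the equation bounds the rest. *)
Lemma null_vec_decomp (I : finType) (a : I -> int) (b : int) (K : nat) :
  let S := (#|I| * K ^ 2 + K)%N in (0 < K)%N ->
  (forall i, `|a i| <= K)%N -> (`|b| <= K)%N ->
  forall z : I -> nat, \sum_i a i * (z i)%:Z = b ->
  exists z0 (t : null_vec a S -> nat),
    [/\ forall i, (z0 i <= S)%N, \sum_i a i * (z0 i)%:Z = b &
        forall i, z i = (z0 i + \sum_h t h * (val h i))%N].
Proof.
move=> S K_gt0 a_le b_le z; have [n] := ubnP (\sum_i z i)%N.
elim: n z => // n IHn z; rewrite ltnS => sum_z sol.
case: (boolP [exists h : null_vec a S, (0 < \sum_i (val h i : nat))%N &&
                [forall i, (val h i <= z i)%N]]).
  case/existsP=> h /andP[h_gt0 /forallP h_le].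
  pose z' i := (z i - val h i)%N.
  have z'K i : (z' i + val h i)%N = z i by rewrite subnK.
  have [||z0 [t [z0_le z0_sol eq_z']]] := IHn z'.
  - apply: leq_trans sum_z; rewrite -(eq_bigr _ (fun i _ => z'K i)) big_split /=.
    by rewrite -[X in (X < _)%N]addn0 ltn_add2l.
  - rewrite -[RHS]sol -[LHS]addr0 -[X in _ + X](eqP (valP h)) -big_split /=.
    by apply: eq_bigr => i _; rewrite -mulrDr -PoszD z'K.
  exists z0, (fun h' => t h' + (h' == h))%N; split=> // i.
  rewrite -z'K eq_z' -addnA; congr (_ + _)%N.
  rewrite [RHS](eq_bigr (fun h' => t h' * val h' i + (h' == h) * val h i)%N); last first.
    by move=> h' _; rewrite mulnDl; case: eqP => [->|].
  rewrite big_split /=; congr (_ + _)%N.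
  by rewrite (bigD1 h) //= eqxx mul1n big1 ?addn0 // => h' /negPf ->.
rewrite negb_exists => /forallP irr.
have no_null (h : I -> nat) : (forall i, h i <= K)%N -> (forall i, h i <= z i)%N ->
    \sum_i a i * (h i)%:Z = 0 -> (\sum_i h i = 0)%N.
  move=> h_leK h_lez h_sol; pose h' := [ffun i => inord (h i) : 'I_S.+1].
  have h'E i : h' i = h i :> nat.
    by rewrite ffunE inordK // ltnS (leq_trans (h_leK i)) // leq_addl.
  have h'_sol : \sum_i a i * (h' i : nat)%:Z == 0.
    by rewrite -[X in _ == X]h_sol; apply/eqP/eq_bigr => i _; rewrite h'E.
  have := irr (exist _ h' h'_sol); rewrite negb_and -leqNgt leqn0 /=.
  rewrite (eq_bigr h) => [|i _]; last exact: h'E.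
  case/orP=> [/eqP //|/negP[]]; apply/forallP => i; by rewrite h'E.
have no_pair i j : 0 < a i -> a j < 0 -> ~~ ((K <= z i) && (K <= z j))%N.
  move=> ai_gt0 aj_lt0; apply/negP => /andP[le_zi le_zj].
  have neq_ij : i != j by apply: contraTneq ai_gt0 => ->; rewrite -leNgt ltW.
  pose h l := if l == i then `|a j|%N else if l == j then `|a i|%N else 0%N.
  have h_i : h i = `|a j|%N by rewrite /h eqxx.
  have h_j : h j = `|a i|%N by rewrite /h eq_sym (negPf neq_ij) eqxx.
  have h_o l : l != i -> l != j -> h l = 0%N by rewrite /h => /negPf-> /negPf->.
  have : (\sum_l h l = 0)%N.
    apply: no_null => [l|l|].
    - by rewrite /h; case: ifP => // _; case: ifP.
    - rewrite /h; case: eqP => [->|_]; first exact: leq_trans (a_le _) le_zi.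
      by case: eqP => [->|//]; apply: leq_trans (a_le _) le_zj.
    rewrite (bigD1 i) //= (bigD1 j) 1?eq_sym //= h_i h_j big1 => [|l /andP[? ?]]; last first.
      by rewrite h_o // mulr0.
    by rewrite addr0; nia.
  by rewrite (bigD1 i) //= h_i; lia.
exists z, (fun=> 0%N); split=> // i; last by rewrite big1 ?addn0.
case: (ltgtP (a i) 0) => [ai_lt0 | ai_gt0 | ai_eq0].
- apply/negPn/negP; rewrite -ltnNge => lt_zi.
  have: (z i <= S)%N; last by rewrite leqNgt lt_zi.
  apply: (@pos_coef_bound I (fun i => - a i) (- b) K z) => [j|||j aj_lt0|].
  + by rewrite abszN.
  + by rewrite abszN.
  + by rewrite -sol -sumrN; apply: eq_bigr => j _; rewrite mulNr.
  + rewrite oppr_lt0 in aj_lt0; have := no_pair _ _ aj_lt0 ai_lt0; lia.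
  by rewrite oppr_gt0.
- apply/negPn/negP; rewrite -ltnNge => lt_zi.
  have: (z i <= S)%N; last by rewrite leqNgt lt_zi.
  apply: (@pos_coef_bound I a b K z) => // j aj_lt0.
  by have := no_pair _ _ ai_gt0 aj_lt0; lia.
case: (posnP (z i)) => [->//|zi_gt0].
(* For a zero coefficient the unit vector at [i] is a null vector below [z], contradicting
   irreducibility. *)
have : (\sum_l (l == i) = 0)%N.
  apply: no_null => [l|l|]; first exact: leq_trans (leq_b1 _) K_gt0.
    by case: eqP => [->|].
  by rewrite (bigD1 i) //= ai_eq0 mul0r add0r big1 // => l /negPf->; rewrite mulr0.
by rewrite (bigD1 i) //= eqxx.
Qed.

(* If s bounds the number of variables, the coefficients and the right-hand sides
   of a system, then sol_growth s bounds those of the system obtained by solving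
   one equation. *)
Definition sol_growth (s : nat) : nat :=
  let S := (s * s ^ 2 + s)%N in (S.+1 ^ s + s + s * s * S + S)%N.

Lemma absz_sum (I : finType) (F : I -> int) : (`|(\sum_i F i)%R| <= \sum_i `|F i|)%N.
Proof. by elim/big_ind2: _ => // x1 x2 y1 y2; lia. Qed.

Lemma absz_sum_le (I : finType) (F : I -> int) (n B : nat) :
  (#|I| <= n)%N -> (forall i, `|F i| <= B)%N -> (`|(\sum_i F i)%R| <= n * B)%N.
Proof.
move=> le_n F_le; apply: leq_trans (absz_sum F) _.
apply: (@leq_trans (\sum_(i : I) B)); first exact: leq_sum.
by rewrite sum_nat_const leq_mul2r le_n orbT.
Qed.

Lemma sol_growth_ge s : (s <= sol_growth s)%N.
Proof. by rewrite /sol_growth -!addnA addnCA leq_addr. Qed.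

Lemma iter_sol_growth_ge n s : (s <= iter n sol_growth s)%N.
Proof. by elim: n => //= n IHn; apply: leq_trans IHn (sol_growth_ge _). Qed.

(* The solutions of one equation are the z0 + \sum_h t h * h with z0 and the null
   vectors h small; substituting leaves a system in t with one equation less. *)
Lemma small_nat_solution m s (I : finType) (a : 'I_m -> I -> int) (b : 'I_m -> int) :
  (0 < s)%N -> (#|I| <= s)%N -> (forall k i, `|a k i| <= s)%N ->
  (forall k, `|b k| <= s)%N ->
  (exists z : I -> nat, forall k, \sum_i a k i * (z i)%:Z = b k) ->
  exists z : I -> nat, (forall k, \sum_i a k i * (z i)%:Z = b k) /\
    forall i, (z i <= iter m.*2 sol_growth s)%N.
Proof.
elim: m s I a b => [|m IHm] s I a b s_gt0 card_le a_le b_le [z sol].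
  by exists (fun=> 0%N); split=> // -[].
have [z0 [t [z0_le z0_sol eq_z]]] :=
  null_vec_decomp s_gt0 (a_le ord0) (b_le ord0) (sol ord0).
move: t z0_le eq_z; set S0 := (#|I| * _ + _)%N => t z0_le eq_z.
pose S := (s * s ^ 2 + s)%N.
have le_S0S : (S0 <= S)%N by rewrite leq_add2r leq_mul2r card_le orbT.
pose H := null_vec (a ord0) S0.
have subst k (t' : H -> nat) :
    \sum_i a k i * (z0 i + \sum_(h : H) t' h * (val h i))%:Z =
    \sum_i a k i * (z0 i)%:Z + \sum_(h : H) (\sum_i a k i * (val h i : nat)%:Z) * (t' h)%:Z.
  under eq_bigr do rewrite PoszD mulrDr.
  rewrite big_split /=; congr (_ + _).
  under [RHS]eq_bigr do rewrite mulr_suml.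
  rewrite exchange_big /=; apply: eq_bigr => i _.
  rewrite -natz natr_sum mulr_sumr; apply: eq_bigr => h _.
  by rewrite natz PoszM; ring.
pose a' (k : 'I_m) (h : H) := \sum_i a (lift ord0 k) i * (val h i : nat)%:Z.
pose b' (k : 'I_m) := b (lift ord0 k) - \sum_i a (lift ord0 k) i * (z0 i)%:Z.
have h_le (h : H) i : (val h i <= S)%N by rewrite (leq_trans _ le_S0S) // -ltnS.
have term_le (k : 'I_m.+1) (x : I -> nat) : (forall i, x i <= S)%N ->
    (`|(\sum_i a k i * (x i)%:Z)%R| <= s * s * S)%N.
  move=> x_le; rewrite -mulnA; apply: absz_sum_le => // i.
  by rewrite abszM; apply: leq_mul (a_le _ _) (x_le _).
(* The summands of [sol_growth s] account for the [S.+1 ^ s] possible null vectors, which are the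
   new unknowns, for the new right-hand sides [s + s * s * S] and coefficients [s * s * S], and for
   the entries of [z0] and of the null vectors. *)
have card_H : (#|{: H}| <= sol_growth s)%N.
  rewrite card_sig; apply: leq_trans (max_card _) _; rewrite card_ffun card_ord.
  apply: (@leq_trans (S.+1 ^ s)); last by rewrite /sol_growth -!addnA leq_addr.
  apply: (@leq_trans (S.+1 ^ #|I|)); last by rewrite leq_pexp2l.
  by case: (#|I|) => // n; rewrite leq_exp2r // ltnS.
have S_le : (S <= sol_growth s)%N by rewrite leq_addl.
have [||k h|k||t' [t'_sol t'_le]] := IHm (sol_growth s) H a' b'.
- exact: leq_trans s_gt0 (sol_growth_ge s).
- exact: card_H.
- by apply: leq_trans (term_le _ _ (h_le h)) _; rewrite /sol_growth -/S; lia.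
- have := term_le (lift ord0 k) z0 (fun i => leq_trans (z0_le i) le_S0S).
  have := b_le (lift ord0 k); rewrite /b' /sol_growth -/S; lia.
- exists t => k; rewrite /b' -(sol (lift ord0 k)).
  under [in RHS]eq_bigr do rewrite eq_z.
  by rewrite subst addrC addKr.
exists (fun i => z0 i + \sum_(h : H) t' h * (val h i))%N; split=> [k|i].
  rewrite subst; case: (unliftP ord0 k) => [k' ->|->].
    by rewrite t'_sol /b' addrC subrK.
  by rewrite z0_sol big1 ?addr0 // => h _; rewrite (eqP (valP h)) mul0r.
(* Of the two additional iterations, the inner one pays for the size of the new system, the outer
   one for the back-substitution, of size at most [x + x * (x * x)]. *)
rewrite doubleS iterS iterSr.
set x := iter m.*2 sol_growth (sol_growth s) in t'_le *.
have le_x : (sol_growth s <= x)%N by apply: iter_sol_growth_ge.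
apply: (@leq_trans (x + x * (x * x))); last first.
  by rewrite /sol_growth -mulnn; lia.
apply: leq_add.
  exact: leq_trans (z0_le i) (leq_trans le_S0S (leq_trans S_le le_x)).
apply: (@leq_trans (\sum_(h : H) x * x)).
  apply: leq_sum => h _; apply: leq_mul => //.
  exact: leq_trans (h_le h i) (leq_trans S_le le_x).
by rewrite sum_nat_const leq_mul2r (leq_trans card_H le_x) orbT.
Qed.

Lemma leq_iter_sol_growth m n s :
  (m <= n)%N -> (iter m sol_growth s <= iter n sol_growth s)%N.
Proof. by move=> /subnK <-; rewrite iterD iter_sol_growth_ge. Qed.

(* Writing c as a difference of natural vectors and adding one slack variable per
   form turns the prescription of all signs into a system of equations. *)
Lemma small_sign_solution (J : finType) (d m s : nat) (L : J -> 'I_d -> int)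
    (b : J -> int) (c : 'I_d -> int) :
  (#|J| <= m)%N -> (0 < s)%N -> (d + d + #|J| <= s)%N ->
  (forall j i, `|L j i| <= s)%N -> (forall j, `|b j| < s)%N ->
  exists c' : 'I_d -> int, (forall i, `|c' i| <= iter m.*2 sol_growth s)%N /\
    forall j, sgz (\sum_i L j i * c' i + b j) = sgz (\sum_i L j i * c i + b j).
Proof.
move=> J_le s_gt0 card_le L_le b_lt.
pose v j := \sum_i L j i * c i + b j.
pose I : finType := ('I_d + 'I_d + J)%type.
(* The equation for [j] says that the form equals [sgz (v j) * (t + 1)] with slack [t]; for sign 0
   the slack drops out. The 1 moves to the right-hand side, which is why [b] is bounded strictly. *)
pose a (k : 'I_#|J|) (x : I) := let j := enum_val k in
  match x with
  | inl (inl i) => L j i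
  | inl (inr i) => - L j i
  | inr j' => - (sgz (v j) *+ (j' == j))
  end.
pose b' (k : 'I_#|J|) := sgz (v (enum_val k)) - b (enum_val k).
have sum_a (z : I -> nat) k : \sum_x a k x * (z x)%:Z =
    \sum_i L (enum_val k) i * ((z (inl (inl i)))%:Z - (z (inl (inr i)))%:Z)
    - sgz (v (enum_val k)) * (z (inr (enum_val k)))%:Z.
  rewrite big_sumType big_sumType /=; congr (_ + _).
    rewrite -big_split /=; apply: eq_bigr => i _; ring.
  rewrite (bigD1 (enum_val k)) //= eqxx big1 ?addr0 ?mulNr //.
  by move=> j /negPf->; rewrite oppr0 mul0r.
have [|||||z [z_sol z_le]] := @small_nat_solution #|J| s I a b'.
- by [].
- by rewrite !card_sum !card_ord.
- move=> k [[i|i]|j] /=; first exact: L_le.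
    by rewrite abszN; apply: L_le.
  by rewrite abszN; case: eqP => _ //; case: sgzP; rewrite //= mulr1n; lia.
- by move=> k; have := b_lt (enum_val k); rewrite /b'; case: sgzP => _ /=; lia.
- pose z (x : I) := match x with
    | inl (inl i) => if 0 <= c i then `|c i|%N else 0%N
    | inl (inr i) => if 0 <= c i then 0%N else `|c i|%N
    | inr j => (`|v j| - `|sgz (v j)|)%N
    end.
  exists z => k; rewrite sum_a /b' /z; set j := enum_val k.
  rewrite (eq_bigr (fun i => L j i * c i)) => [|i _]; last first.
    by congr (_ * _); case: ifP; lia.
  apply/eqP; rewrite -(can2_eq (subrK _) (addrK _)) opprK addrAC -/(v j).
  by apply/eqP; case: (sgzP (v j)); lia.
exists (fun i => (z (inl (inl i)))%:Z - (z (inl (inr i)))%:Z); split=> [i|j].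
  have le_m : (iter #|J|.*2 sol_growth s <= iter m.*2 sol_growth s)%N.
    by rewrite leq_iter_sol_growth // leq_double.
  have := leq_trans (z_le (inl (inl i))) le_m.
  have := leq_trans (z_le (inl (inr i))) le_m.
  by move: (iter _ _ _) (z _) (z _) => B x y; lia.
have := z_sol (enum_rank j); rewrite sum_a /b' enum_rankK.
rewrite -/(v j); set t := z _; set r := \sum_(_ | _) _ => eq_r.
have -> : r + b j = sgz (v j) * t.+1%:Z by lia.
by rewrite sgzM sgz_id [sgz _%:Z]gtr0_sgz // mulr1.
Qed.

(** * Signs of exponential polynomials *)

Definition shift_sub (l : int) (u : nat -> int) : nat -> int :=
  fun n => u n.+1 - l * u n.

Fixpoint shift_subs (ls : seq int) (u : nat -> int) : nat -> int :=
  if ls is l :: ls' then shift_subs ls' (shift_sub l u) else u.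

(* For ls = [:: l_1; ...; l_k] increasing, the last of the values at 0 of u,
   (E - l_1) u, (E - l_2) (E - l_1) u, ... that does not vanish comes from the
   dominant term of u, where E is the shift. *)
Fixpoint lead_sgn (ls : seq int) (u : nat -> int) : int :=
  if ls is l :: ls' then
    let s := lead_sgn ls' (shift_sub l u) in if s == 0 then sgz (u 0%N) else s
  else 0.

(** Only the signs of [size ls] values matter; for orbits these values are affine forms in the
    initial point. *)
Lemma eq_lead_sgn ls u v :
  (forall i, (i < size ls)%N ->
     sgz (shift_subs (take i ls) u 0%N) = sgz (shift_subs (take i ls) v 0%N)) ->
  lead_sgn ls u = lead_sgn ls v.
Proof.
elim: ls u v => //= l ls IHls u v eq_sgn.
rewrite (IHls _ (shift_sub l v)) => [|i lti]; last exact: (eq_sgn i.+1).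
by have /= -> := eq_sgn 0%N isT.
Qed.

Lemma lead_sgn_norm ls u : `|lead_sgn ls u| = (lead_sgn ls u != 0)%:Z.
Proof.
elim: ls u => //= l ls IHls u; case: eqP => [_|/eqP s_neq0].
  by case: (sgzP (u 0%N)).
by rewrite IHls s_neq0.
Qed.

(** While [w] is negative, [l * w n >= mu * w n], so [mu * w (N + t)] divided by [mu ^ t] gains at
    least 1 per step. Hence [w] becomes non-negative within [|mu * w N|] steps; it then stays so,
    and [w n.+1 >= mu ^ n]. *)
Lemma linear_growth (w : nat -> int) (l mu : int) (N : nat) :
  0 <= l <= mu -> 0 < mu ->
  (forall n, (N <= n)%N -> l * w n + mu ^+ n <= w n.+1) ->
  forall n, (N + `|(mu * w N)%R| < n)%N -> mu ^+ n <= mu * w n.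
Proof.
move=> /andP[l_ge0 le_lmu] mu_gt0 w_rec.
have mu_ge1 k : 1 <= mu ^+ k by rewrite exprn_ege1 //; lia.
have stay n0 : (N <= n0)%N -> 0 <= w n0 -> forall n, (n0 < n)%N -> mu ^+ n <= mu * w n.
  move=> le_N w_ge0 n lt_n.
  have pos k : 0 <= w (n0 + k)%N.
    elim: k => [|k IHk]; first by rewrite addn0.
    rewrite addnS; apply: le_trans (w_rec _ (leq_trans le_N (leq_addr _ _))).
    by rewrite addr_ge0 ?mulr_ge0 ?exprn_ge0 // ltW.
  have {lt_n} -> : n = (n0 + (n - n0.+1)).+1 by lia.
  rewrite exprS ler_wpM2l ?(ltW mu_gt0) //.
  apply: le_trans (w_rec _ (leq_trans le_N (leq_addr _ _))).
  by rewrite ler_wpDl // mulr_ge0.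
have cross t : (exists2 n0, (N <= n0 <= N + t)%N & 0 <= w n0) \/
    mu ^+ t * (mu * w N + t%:Z) <= mu * w (N + t)%N.
  elim: t => [|t [[n0 /andP[le_n0 ge_n0] w_ge0]|IHt]].
  - by right; rewrite mul1r !addn0 addr0.
  - by left; exists n0 => //; lia.
  case: (lerP 0 (w (N + t)%N)) => [w_ge0|w_lt0].
    by left; exists (N + t)%N => //; lia.
  right; rewrite addnS exprS -mulrA ler_wpM2l ?(ltW mu_gt0) //.
  apply: le_trans (w_rec _ (leq_addr _ _)).
  have -> : mu * w N + t.+1%:Z = mu * w N + t%:Z + 1 by lia.
  rewrite mulrDr mulr1.
  apply: lerD; last by rewrite ler_weXn2l ?leq_addl //; lia.
  by apply: le_trans IHt _; rewrite ler_wnM2r // ltW.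
move=> n lt_n; case: (cross `|(mu * w N)%R|%N) => [[n0 /andP[le_n0 ge_n0] w_ge0]|].
  by apply: (stay n0) => //; lia.
set t := `|_|%N => mu_le; apply: (stay (N + t)%N) => //; first exact: leq_addr.
rewrite -(pmulr_rge0 _ mu_gt0); apply: le_trans mu_le.
by rewrite mulr_ge0 ?exprn_ge0 ?(ltW mu_gt0) // /t; lia.
Qed.

(** Each root costs one application of [linear_growth]; started at time [t], its waiting time is at
    most [H * q ^ t], and the successor makes the inequality strict. *)
Definition sign_delay (H q k : nat) := iter k (fun t => (t + H * q ^ t).+1) 0%N.

(** If the lead sign of [shift_sub l u] is 0, that sequence vanishes and [u n = l ^+ n * u 0].
    Otherwise it grows, up to sign and a factor, at least like the powers of some [mu]; as the roots
    increase, [l <= mu], and [linear_growth] passes the growth on to [u]. The integer [E] collects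
    the factor [mu] that each such stage costs. *)
Lemma lead_sgnP (ls : seq int) (u : nat -> int) (l0 : int) (Lam C H q : nat) :
  0 < l0 -> path <=%R l0 ls -> all (fun l => l <= Lam%:Z) ls ->
  (forall n, shift_subs ls u n = 0) ->
  (forall i n, `|shift_subs (take i ls) u n| <= C * q ^ n)%N ->
  (Lam ^ size ls * C <= H)%N ->
  (lead_sgn ls u = 0 -> forall n, u n = 0) /\
  (lead_sgn ls u != 0 -> exists E mu : int,
     [/\ 0 < E <= (Lam ^ size ls)%:Z, l0 <= mu <= Lam%:Z &
      forall n, (sign_delay H q (size ls) <= n)%N ->
        mu ^+ n <= E * lead_sgn ls u * u n]).
Proof.
elim: ls u l0 H => [|l ls IHls] u l0 H l0_gt0 /=.
  by move=> _ _ u_eq0 _ _; split=> // /eqP.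
case/andP=> le_l0 path_ls /andP[le_l all_ls] u_rec u_le H_ge.
have l_gt0 : 0 < l by apply: lt_le_trans le_l0.
have Lam_gt0 : (0 < Lam)%N by lia.
have [|i n||IH0 IH1] := IHls (shift_sub l u) l H l_gt0 path_ls all_ls.
- exact: u_rec.
- exact: (u_le i.+1).
- by apply: leq_trans H_ge; rewrite expnS -mulnA leq_pmull.
case: (eqVneq (lead_sgn ls (shift_sub l u)) 0) => [s_eq0|s_neq0].
  have u_geo n : u n = l ^+ n * u 0%N.
    elim: n => [|n IHn]; first by rewrite mul1r.
    have /eqP := IH0 s_eq0 n; rewrite subr_eq0 => /eqP ->.
    by rewrite IHn exprS mulrA.
  rewrite sgz_eq0; split=> [/eqP|u0_neq0].
    by rewrite sgz_eq0 => /eqP u0 n; rewrite u_geo u0 mulr0.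
  exists 1, l; split=> [||n _].
  - by rewrite ltr01 lez_nat expn_gt0 Lam_gt0.
  - by rewrite le_l0.
  rewrite mul1r (u_geo n) mulrCA -[X in X <= _]mulr1 ler_wpM2l ?exprn_ge0 ?(ltW l_gt0) //.
  by rewrite -abszEsg; lia.
split=> [s_eq0|_]; first by rewrite s_eq0 eqxx in s_neq0.
have [E [mu [/andP[E_gt0 E_le] /andP[le_mu mu_le] growth]]] := IH1 s_neq0.
set s := lead_sgn _ _ in s_neq0 growth *.
have s_norm : `|s| = 1 by rewrite lead_sgn_norm s_neq0.
have mu_gt0 : 0 < mu by apply: lt_le_trans le_mu.
set N := sign_delay H q (size ls) in growth.
exists (mu * E), mu; split=> [||n].
- by rewrite mulr_gt0 //= expnS PoszM ler_pM // ltW.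
- by rewrite mu_le (le_trans le_l0).
rewrite /sign_delay /= -/N => lt_n.
have -> : mu * E * s * u n = mu * (E * s * u n) by rewrite !mulrA.
apply: (@linear_growth (fun n => E * s * u n) l mu N).
- by rewrite (ltW l_gt0).
- by [].
- move=> k le_Nk; rewrite -lerBrDl; apply: le_trans (growth k le_Nk) _.
  by rewrite /shift_sub le_eqVlt; apply/orP; left; apply/eqP; ring.
apply: leq_ltn_trans lt_n; rewrite leq_add2l.
rewrite !abszM mulnA (_ : `|s|%N = 1)%N ?mul1n; last by lia.
have u_leN : (`|u N| <= C * q ^ N)%N by have := u_le 0%N N; rewrite take0.
apply: leq_trans (leq_mul (leqnn _) u_leN) _; rewrite mulnA leq_mul2r; apply/orP; right.
by apply: leq_trans H_ge; rewrite leq_mul2r expnS leq_mul ?orbT //; lia.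
Qed.

(** * Orbits of triangular maps *)

Lemma eq_shift_subs ls u v : u =1 v -> shift_subs ls u =1 shift_subs ls v.
Proof.
elim: ls u v => //= l ls IHls u v eq_uv; apply: IHls => n.
by rewrite /shift_sub !eq_uv.
Qed.

Lemma shift_subs_cat s t u : shift_subs (s ++ t) u = shift_subs t (shift_subs s u).
Proof. by elim: s u => //= l s IHs u. Qed.

Lemma shift_subs_sub l ls u :
  shift_subs ls (shift_sub l u) =1 shift_sub l (shift_subs ls u).
Proof.
elim: ls u => //= k ls IHls u n; rewrite -IHls; apply: eq_shift_subs => {}n.
by rewrite /shift_sub; ring.
Qed.

Lemma shift_subsC s t u :
  shift_subs s (shift_subs t u) =1 shift_subs t (shift_subs s u).
Proof.
elim: s u => //= l s IHs u n; rewrite -IHs; apply: eq_shift_subs => {}n.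
by rewrite -shift_subs_sub.
Qed.

Lemma perm_shift_subs s t u :
  perm_eq s t -> shift_subs s u =1 shift_subs t u.
Proof.
move=> eq_st; pose P r := shift_subs s u =1 shift_subs r u.
suff: P t by [].
apply: (catCA_perm_ind (P := P)) eq_st _ => // s1 s2 s3 P123 n.
by rewrite P123 !shift_subs_cat; apply: eq_shift_subs => {}n; rewrite shift_subsC.
Qed.

Lemma shift_subs_nseq0 k u n : shift_subs (nseq k 0) u n = u (n + k)%N.
Proof.
elim: k u n => [|k IHk] u n /=; first by rewrite addn0.
by rewrite IHk /shift_sub mul0r subr0 addnS.
Qed.

Lemma shift_subs_addn ls u k n :
  shift_subs ls (fun m => u (m + k)%N) n = shift_subs ls u (n + k)%N.
Proof. by elim: ls u n => //= l ls IHls u n; rewrite -IHls; apply: eq_shift_subs. Qed.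

Lemma shift_subs0 ls n : shift_subs ls (fun=> 0) n = 0.
Proof.
elim: ls n => //= l ls IHls n; apply: etrans (IHls n); apply: eq_shift_subs => m.
by rewrite /shift_sub /= mulr0 subr0.
Qed.

Lemma shift_subsD ls u v n :
  shift_subs ls (fun m => u m + v m) n = shift_subs ls u n + shift_subs ls v n.
Proof.
elim: ls u v n => //= l ls IHls u v n; rewrite -IHls; apply: eq_shift_subs => m.
by rewrite /shift_sub; ring.
Qed.

Lemma shift_subsZ ls c u n :
  shift_subs ls (fun m => u m * c) n = shift_subs ls u n * c.
Proof.
elim: ls u n => //= l ls IHls u n; rewrite -IHls; apply: eq_shift_subs => m.
by rewrite /shift_sub; ring.
Qed.

Lemma shift_subs_sum (I : Type) (r : seq I) ls (F : I -> nat -> int) n :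
  shift_subs ls (fun m => \sum_(i <- r) F i m) n = \sum_(i <- r) shift_subs ls (F i) n.
Proof.
elim: r => [|i r IHr].
  rewrite big_nil -[RHS](shift_subs0 ls n); apply: eq_shift_subs => m.
  by rewrite big_nil.
rewrite big_cons -IHr -shift_subsD; apply: eq_shift_subs => m.
by rewrite big_cons.
Qed.

Lemma shift_subs_bound ls u (C q Lam : nat) :
  all (fun l => `|l|%N <= Lam)%N ls ->
  (forall n, `|u n|%N <= C * q ^ n)%N ->
  forall n, (`|shift_subs ls u n|%N <= C * (q + Lam) ^ size ls * q ^ n)%N.
Proof.
elim: ls u C => [|l ls IHls] u C /=; first by move=> _ u_le n; rewrite muln1.
case/andP=> l_le ls_le u_le n; rewrite expnS mulnA.
apply: IHls => // {}n; rewrite /shift_sub.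
apply: (@leq_trans (`|u n.+1| + `|l| * `|u n|)); first by rewrite -abszM; lia.
rewrite mulnDr mulnDl leq_add // -?mulnA -?expnS //.
by rewrite mulnCA leq_mul.
Qed.

(** Each factor splits into [A - A i i] and [A + A i i]. All of these are polynomials in [A], so the
    first halves can be gathered into the characteristic polynomial. *)
Lemma triangular_prod (d : nat) (A : 'M[int]_d.+1) : triangular A ->
  \prod_(l <- [seq A i i ^+ 2 | i <- enum 'I_d.+1]) (A ^+ 2 - l%:M) = 0.
Proof.
move=> tri_A.
have char_A : char_poly A = \prod_i ('X - (A i i)%:P).
  case: tri_A => [upA | loA]; last by apply/char_poly_trig/is_trig_mxP.
  have -> : char_poly A = char_poly A^T.
    rewrite /char_poly -det_tr; congr (\det _); apply/matrixP => i j.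
    by rewrite !mxE eq_sym.
  rewrite char_poly_trig; first by apply: eq_bigr => i _; rewrite mxE.
  by apply/is_trig_mxP => i j lt_ij; rewrite mxE upA.
have := Cayley_Hamilton A; rewrite char_A => CH.
rewrite big_map.
transitivity (horner_mx A (\prod_(i <- enum 'I_d.+1) ('X - (A i i)%:P)
                           * \prod_(i <- enum 'I_d.+1) ('X + (A i i)%:P))).
  rewrite -big_split rmorph_prod /=; apply: eq_bigr => i _.
  by rewrite -subr_sqr rmorphB !rmorphXn /= horner_mx_X horner_mx_C.
by rewrite rmorphM /= big_enum CH mul0r.
Qed.

(** On these sequences [shift_sub l] acts by multiplying [w] by [B - l%:M]. *)
Lemma shift_subs_mx (d : nat) (B : 'M[int]_d.+1) (g : 'rV_d.+1) (w : 'cV_d.+1) ls n :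
  shift_subs ls (fun m => (g *m (B ^+ m *m w)) 0 0) n =
  (g *m (B ^+ n *m (\prod_(l <- ls) (B - l%:M) *m w))) 0 0.
Proof.
elim: ls w n => [|l ls IHls] w n; first by rewrite big_nil mul1mx.
rewrite big_cons /=.
rewrite (@eq_shift_subs ls _ (fun m => (g *m (B ^+ m *m ((B - l%:M) *m w))) 0 0)).
  rewrite IHls; congr ((_ *m (_ *m _)) _ _).
  rewrite mulmxA; congr (_ *m _).
  have comm_l : GRing.comm (B - l%:M) (\prod_(k <- ls) (B - k%:M)).
    apply: commr_prod => k _; apply: commrB; last exact: comm_mx_scalar.
    apply/commr_sym/commrB; first by [].
    exact: comm_mx_scalar.
  exact: esym comm_l.
move=> m; rewrite /shift_sub mulmxBl mul_scalar_mx !mulmxBr -!scalemxAr.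
have -> (M N : 'M[int]_1) : (M - l *: N) 0 0 = M 0 0 - l * N 0 0 by rewrite !mxE.
by rewrite exprSr -[B ^+ m * B]/(B ^+ m *m B) -!mulmxA.
Qed.

Definition affine_map (d : nat) (A : 'M[int]_d) (a x : 'cV[int]_d) : 'cV[int]_d :=
  A *m x + a.

Lemma iter_affine_mapB (d : nat) (A : 'M[int]_d) (a x y : 'cV[int]_d) n :
  iter n (affine_map A a) x - iter n (affine_map A a) y = A ^+ n *m (x - y).
Proof.
elim: n => [|n IHn]; first by rewrite mul1mx.
rewrite !iterS /affine_map opprD addrACA subrr addr0 -mulmxBr IHn.
by rewrite exprS -[A * _]/(A *m _) mulmxA.
Qed.

Definition atom_val (d : nat) (g : 'rV[int]_d * int) (x : 'cV[int]_d) : int :=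
  (g.1 *m x) 0 0 + g.2.

(* Iterating the loop twice squares the diagonal entries, and the first X
   iterations absorb the nilpotent part, so that only positive roots remain. *)
Definition orbit_val (d : nat) (A : 'M[int]_d) (a : 'cV[int]_d)
    (X : nat) (p : bool) (g : 'rV[int]_d * int) (c : 'cV[int]_d) (m : nat) : int :=
  atom_val g (iter ((m + X).*2 + p) (affine_map A a) c).

(** The root 1 accounts for the translation and for the constant of the inequality: both cancel in a
    difference of successive values. *)
Definition pos_roots (d : nat) (A : 'M[int]_d) : seq int :=
  sort <=%R (1 :: [seq l <- [seq A i i ^+ 2 | i <- enum 'I_d] | l != 0]).

Lemma size_pos_roots d (A : 'M[int]_d) : (size (pos_roots A) <= d.+1)%N.
Proof.
rewrite size_sort /= ltnS size_filter (leq_trans (count_size _ _)) //.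
by rewrite size_map size_enum_ord.
Qed.

Lemma path_pos_roots d (A : 'M[int]_d) : path <=%R 1 (pos_roots A).
Proof.
rewrite path_min_sorted; first exact: sort_le_sorted.
apply/allP => l; rewrite mem_sort inE => /orP[/eqP->//|].
rewrite mem_filter => /andP[l_neq0 /mapP[i _ eq_l]]; rewrite eq_l in l_neq0 *.
by rewrite -gtz0_ge1 lt_neqAle eq_sym l_neq0 sqr_ge0.
Qed.

Lemma pos_roots_le d (A : 'M[int]_d) (X : nat) : (forall i, `|A i i|%N <= X)%N ->
  forall l, l \in pos_roots A -> 0 <= l <= (X ^ 2).+1%:Z.
Proof.
move=> A_le l; rewrite mem_sort inE => /orP[/eqP->|]; first by rewrite ler01 /=; lia.
rewrite mem_filter => /andP[_ /mapP[i _ ->]]; rewrite sqr_ge0 /=.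
have := A_le i; nia.
Qed.

(** The [z] zero roots act as a shift by [z <= X]; taken out of the time shift, they complete the
    roots to [1 :: D]. The root 1 leaves a linear sequence, started from the difference of the
    iterates [p.+2] and [p] of [c], and [triangular_prod] annihilates it. *)
Lemma orbit_val_rec d (A : 'M[int]_d.+1) a X p g c n : triangular A ->
  (d.+1 <= X)%N -> shift_subs (pos_roots A) (orbit_val A a X p g c) n = 0.
Proof.
move=> tri_A le_dX.
pose v m := atom_val g (iter (m.*2 + p) (affine_map A a) c).
pose D := [seq A i i ^+ 2 | i <- enum 'I_d.+1].
pose z := count (pred1 0) D.
have le_zX : (z <= X)%N.
  by rewrite (leq_trans _ le_dX) // (leq_trans (count_size _ _)) // size_map size_enum_ord.
rewrite (@shift_subs_addn _ v).
have <- : ((n + X - z) + z = n + X)%N by lia.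
set m := (n + X - z)%N.
rewrite -(@shift_subs_addn _ v).
rewrite -(@eq_shift_subs _ (shift_subs (nseq z 0) v)) => [|k]; last exact: shift_subs_nseq0.
rewrite -shift_subs_cat (@perm_shift_subs _ (1 :: D)).
  rewrite /= (@eq_shift_subs _ _ (fun k => (g.1 *m ((A ^+ 2) ^+ k *m
      (iter p.+2 (affine_map A a) c - iter p (affine_map A a) c))) 0 0)).
    by rewrite shift_subs_mx triangular_prod // mul0mx !mulmx0 mxE.
  move=> k; rewrite /shift_sub mul1r /v /atom_val.
  rewrite opprD addrACA subrr addr0.
  have -> (M N : 'M[int]_1) : M 0 0 - N 0 0 = (M - N) 0 0 by rewrite !mxE.
  rewrite -mulmxBr doubleS !addSn -!addnS [(_ + p.+2)%N]addnC [(_ + p)%N]addnC.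
  by rewrite addnC iterD [(p + _)%N]addnC iterD iter_affine_mapB -exprM mul2n.
apply: (@perm_trans _ (nseq z 0 ++ [:: 1] ++ [seq l <- D | l != 0])).
  by rewrite perm_cat2l perm_sort.
rewrite perm_catCA /= perm_cons.
suff -> : nseq z 0 = [seq l <- D | l == 0] by rewrite perm_filterC.
by rewrite /z; elim: (D) => //= l s IHs; case: eqP => [->|//] /=; rewrite IHs.
Qed.

(** * Explicit bounds along orbits *)

Definition map_growth (X : nat) : nat := (X ^ 2 + X + 1)%N.

(** [X.+1] counts the coordinates and the constant of an inequality; [X.*2.+1] bounds the number of
    iterations preceding index 0 of [orbit_val]. *)
Definition orbit_scale (X G B : nat) : nat :=
  (X.+1 * G * map_growth X ^ X.*2.+1 * B.+1)%N.

Definition root_bound (X : nat) : nat := (X ^ 2).+1.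

Definition shift_scale (X : nat) : nat :=
  ((map_growth X ^ 2 + root_bound X) ^ X.+1)%N.

Lemma map_growth_gt0 X : (0 < map_growth X)%N.
Proof. by rewrite /map_growth addn1. Qed.

Lemma affine_coord (d : nat) (g : 'rV[int]_d) (x : 'cV[int]_d) (X G B : nat) :
  (d <= X)%N -> (forall j, `|(g 0 j)%R| <= G)%N -> (forall j, `|(x j 0)%R| <= B)%N ->
  (`|((g *m x) 0 0)%R| <= X * (G * B))%N.
Proof.
move=> le_dX g_le x_le; rewrite mxE; apply: absz_sum_le; first by rewrite card_ord.
by move=> j; rewrite abszM leq_mul.
Qed.

(** Entries below [b] are mapped to entries of size at most [X * (X * b.-1) + X], which is less than
    [map_growth X * b]. *)
Lemma iter_affine_map_lt (d : nat) (A : 'M[int]_d) (a c : 'cV[int]_d) (X B n : nat) :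
  (d <= X)%N -> (forall i j, `|(A i j)%R| <= X)%N -> (forall i, `|(a i 0)%R| <= X)%N ->
  (forall i, `|(c i 0)%R| <= B)%N ->
  forall i, (`|(iter n (affine_map A a) c i 0)%R| < map_growth X ^ n * B.+1)%N.
Proof.
move=> le_dX A_le a_le c_le; elim: n => [|n IHn] i.
  by rewrite mul1n ltnS; apply: c_le.
set x := iter n _ _ in IHn; set b := (_ * _)%N in IHn.
rewrite iterS -/x mxE expnS -mulnA -/b.
have Ax_le : (`|((A *m x) i 0)%R| <= X * (X * b.-1))%N.
  have -> : (A *m x) i 0 = (row i A *m x) 0 0 by rewrite -row_mul [RHS]mxE.
  apply: affine_coord => // j; first by rewrite mxE.
  by rewrite -ltnS (ltn_predK (IHn j)).
have := a_le i; have := IHn i; move: Ax_le; rewrite /map_growth.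
move: ((A *m x) i 0) (a i 0) => u v; case: (b) => //= b' *; nia.
Qed.

Lemma orbit_val_bound (d : nat) (A : 'M[int]_d) (a c : 'cV[int]_d) (X G B : nat)
    (p : bool) (g : 'rV[int]_d * int) m :
  (d <= X)%N -> (forall i j, `|(A i j)%R| <= X)%N -> (forall i, `|(a i 0)%R| <= X)%N ->
  (forall j, `|(g.1 0 j)%R| <= G)%N -> (`|g.2| <= G)%N ->
  (forall i, `|(c i 0)%R| <= B)%N ->
  (`|orbit_val A a X p g c m|%N <= orbit_scale X G B * (map_growth X ^ 2) ^ m)%N.
Proof.
move=> le_dX A_le a_le g_le g0_le c_le; set q := map_growth X.
have q_gt0 : (0 < q)%N by apply: map_growth_gt0.
pose b := (q ^ X.*2.+1 * B.+1 * (q ^ 2) ^ m)%N.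
have b_gt0 : (0 < b)%N by rewrite !muln_gt0 !expn_gt0 q_gt0.
have x_le j : (`|(iter ((m + X).*2 + p) (affine_map A a) c j 0)%R| <= b)%N.
  apply: leq_trans (ltnW (iter_affine_map_lt _ le_dX A_le a_le c_le _)) _.
  rewrite /b mulnAC leq_mul2r -expnM -expnD leq_pexp2l ?orbT //.
  by case: (p) => /=; lia.
have := affine_coord le_dX g_le x_le; rewrite /orbit_val /atom_val.
have -> : (orbit_scale X G B * (q ^ 2) ^ m = X.+1 * (G * b))%N.
  by rewrite /orbit_scale /b -/q; lia.
have : (G <= G * b)%N by rewrite leq_pmulr.
by move: (_ *m _) => y; lia.
Qed.

Lemma leq_sign_delay H q j k : (j <= k)%N -> (sign_delay H q j <= sign_delay H q k)%N.
Proof.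
move/subnK <-; elim: (k - j)%N => // n IHn; apply: leq_trans IHn _.
by rewrite addSn /sign_delay /= -addnS leq_addr.
Qed.

Definition decision_time (X G B : nat) : nat :=
  sign_delay (root_bound X ^ X.+1 * (orbit_scale X G B * shift_scale X))
             (map_growth X ^ 2) X.+1.

Lemma shift_orbit_bound (d : nat) (A : 'M[int]_d.+1) (u : nat -> int) (X C i n : nat) :
  (d.+1 <= X)%N -> (forall i, `|(A i i)%R| <= X)%N ->
  (forall n, `|u n|%N <= C * (map_growth X ^ 2) ^ n)%N ->
  (`|shift_subs (take i (pos_roots A)) u n|%N <=
     C * shift_scale X * (map_growth X ^ 2) ^ n)%N.
Proof.
move=> le_dX A_le u_le.
have roots_le : all (fun l => `|l| <= root_bound X)%N (take i (pos_roots A)).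
  apply/allP => l /mem_take /(pos_roots_le A_le); rewrite /root_bound; lia.
apply: leq_trans (shift_subs_bound roots_le u_le n) _.
rewrite leq_mul2r leq_mul2l /shift_scale leq_pexp2l ?orbT //.
  by rewrite /root_bound addnS.
by rewrite size_take_min (leq_trans (geq_minr _ _)) // (leq_trans (size_pos_roots A)).
Qed.

(** The right-hand side does not depend on [m]: one test after the decision time settles all later
    iterates of the same parity. *)
Lemma orbit_val_sign (d : nat) (A : 'M[int]_d.+1) (a c : 'cV[int]_d.+1) (X G B : nat)
    (p : bool) (g : 'rV[int]_d.+1 * int) m :
  triangular A -> (d.+1 <= X)%N -> (forall i j, `|(A i j)%R| <= X)%N ->
  (forall i, `|(a i 0)%R| <= X)%N ->
  (forall j, `|(g.1 0 j)%R| <= G)%N -> (`|g.2| <= G)%N ->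
  (forall i, `|(c i 0)%R| <= B)%N -> (decision_time X G B <= m)%N ->
  (0 < orbit_val A a X p g c m) =
  (lead_sgn (pos_roots A) (orbit_val A a X p g c) == 1).
Proof.
move=> tri_A le_dX A_le a_le g_le g0_le c_le le_m.
set u := orbit_val A a X p g c; set ls := pos_roots A.
have u_le n : (`|u n|%N <= orbit_scale X G B * (map_growth X ^ 2) ^ n)%N.
  exact: orbit_val_bound.
have Aii_le i : (`|(A i i)%R| <= X)%N by [].
have le_size : (size ls <= X.+1)%N by apply: leq_trans (size_pos_roots A) _.
pose H := (root_bound X ^ X.+1 * (orbit_scale X G B * shift_scale X))%N.
have [||n|i n||s0 s1] := @lead_sgnP ls u 1 (root_bound X)
    (orbit_scale X G B * shift_scale X) H (map_growth X ^ 2) _ (path_pos_roots A).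
- by [].
- by apply/allP => l /(pos_roots_le Aii_le)/andP[].
- exact: orbit_val_rec.
- exact: shift_orbit_bound.
- by rewrite leq_mul2r leq_pexp2l ?orbT.
case: (eqVneq (lead_sgn ls u) 0) => [s_eq0|s_neq0].
  by rewrite (s0 s_eq0 m) s_eq0 ltxx.
have [E [mu [/andP[E_gt0 _] /andP[mu_ge1 _] growth]]] := s1 s_neq0.
have {growth} : 0 < E * lead_sgn ls u * u m.
  apply: lt_le_trans (growth m (leq_trans (leq_sign_delay _ _ le_size) le_m)).
  by rewrite exprn_gt0 // (lt_le_trans ltr01).
rewrite -mulrA pmulr_rgt0 //.
have := lead_sgn_norm ls u; rewrite s_neq0 => s_norm.
have [->|->] : lead_sgn ls u = 1 \/ lead_sgn ls u = -1 by lia.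
  by rewrite mul1r eqxx.
by rewrite mulN1r oppr_gt0 => u_lt0; rewrite ltNge ltW.
Qed.

(** With coefficients written as orbit values at 0 and at unit vectors, [orbit_val_bound] for
    [B = 1] controls them. *)
Lemma orbit_val_affine (d : nat) (A : 'M[int]_d) (a c : 'cV[int]_d) X p g m :
  orbit_val A a X p g c m =
  \sum_j (orbit_val A a X p g (delta_mx j 0) m - orbit_val A a X p g 0 m) * c j 0
  + orbit_val A a X p g 0 m.
Proof.
set n := ((m + X).*2 + p)%N.
have diff x : orbit_val A a X p g x m - orbit_val A a X p g 0 m =
    ((g.1 *m A ^+ n) *m x) 0 0.
  rewrite /orbit_val /atom_val opprD addrACA subrr addr0 -/n.
  have -> (M N : 'M[int]_1) : M 0 0 - N 0 0 = (M - N) 0 0 by rewrite !mxE.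
  by rewrite -mulmxBr iter_affine_mapB subr0 mulmxA.
apply/eqP; rewrite -subr_eq diff; apply/eqP; rewrite mxE.
apply: eq_bigr => j _; rewrite diff -colE; congr (_ * _).
by rewrite [RHS]mxE.
Qed.

(** The summands bound the coefficients, which are differences of two shifted orbit values, the
    positive and negative parts of the coordinates, and the slack variables, one per inequality,
    parity and root. *)
Definition system_size (X G : nat) : nat :=
  ((orbit_scale X G 1).*2 * shift_scale X + X.*2 + X * 2 * X.+1).+1.

Definition solution_bound (X G : nat) : nat :=
  iter (X * 2 * X.+1).*2 sol_growth (system_size X G).

(** [solution_bound X G] does not involve [Y], so [Y] can be chosen above it afterwards, without
    circularity. *)
Lemma nonterminating_bounded (d : nat) (A : 'M[int]_d.+1) (a : 'cV[int]_d.+1)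
    (R : finType) (g : R -> 'rV[int]_d.+1 * int) (X G Y : nat) :
  triangular A -> (d.+1 <= X)%N -> (#|R| <= X)%N ->
  (forall i j, `|(A i j)%R| <= X)%N -> (forall i, `|(a i 0)%R| <= X)%N ->
  (forall r j, `|((g r).1 0 j)%R| <= G)%N -> (forall r, `|(g r).2| <= G)%N ->
  (forall c, (forall n r, 0 < atom_val (g r) (iter n (affine_map A a) c)) ->
     exists2 c' : 'cV[int]_d.+1, (forall j, `|(c' j 0)%R| <= solution_bound X G)%N &
       (solution_bound X G <= Y)%N ->
       forall r (p : bool), 0 < orbit_val A a X p (g r) c' (decision_time X G Y)) /\
  (forall c : 'cV[int]_d.+1, (forall j, `|(c j 0)%R| <= Y)%N ->
     (forall r (p : bool), 0 < orbit_val A a X p (g r) c (decision_time X G Y)) ->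
     exists c', forall n r, 0 < atom_val (g r) (iter n (affine_map A a) c')).
Proof.
move=> tri_A le_dX le_RX A_le a_le g_le g0_le; set N := decision_time X G Y.
set ls := pos_roots A.
split=> [c c_pos|c c_le c_pos]; last first.
  (* The witness is a late iterate of [c], since the guard may fail at [c] itself or soon after. *)
  exists (iter (N + X).*2 (affine_map A a) c) => n r; rewrite -iterD.
  have -> : (n + (N + X).*2 = (n./2 + N + X).*2 + odd n)%N.
    by rewrite -{1}(odd_double_half n); lia.
  have := c_pos r (odd n).
  by rewrite -/(orbit_val A a X (odd n) (g r) c _) !(@orbit_val_sign _ _ _ _ _ G Y) ?leq_addl.
(* As [c] need not be bounded by [Y], its lead signs are read at the decision time for its own
   largest entry. *)
have lead_c r p : lead_sgn ls (orbit_val A a X p (g r) c) = 1.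
  apply/eqP; rewrite -(@orbit_val_sign _ _ _ _ _ G (\max_j `|(c j 0)%R|%N)
    _ _ (decision_time X G (\max_j `|(c j 0)%R|%N))) //; first exact: c_pos.
  by move=> i; apply: (leq_bigmax (F := fun j => `|(c j 0)%R|%N)).
pose J : finType := (R * bool * 'I_(size ls))%type.
pose sh (j : J) (x : 'cV[int]_d.+1) :=
  shift_subs (take j.2 ls) (orbit_val A a X j.1.2 (g j.1.1) x) 0%N.
pose L (j : J) i := sh j (delta_mx i 0) - sh j 0.
have sh_affine j (x : 'cV[int]_d.+1) : \sum_i L j i * x i 0 + sh j 0 = sh j x.
  pose o y := orbit_val A a X j.1.2 (g j.1.1) y.
  pose F i m := (o (delta_mx i 0) m - o 0 m) * x i 0.
  rewrite /sh [RHS](@eq_shift_subs _ _ (fun m => \sum_i F i m + o 0 m)); last first.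
    by move=> m; rewrite (orbit_val_affine _ _ x).
  rewrite [RHS]shift_subsD shift_subs_sum.
  congr (_ + _); apply: eq_bigr => i _; rewrite shift_subsZ; congr (_ * _).
  rewrite /L /sh -[- shift_subs _ _ _]mulrN1 -shift_subsZ -shift_subsD.
  by apply: eq_shift_subs => m; rewrite mulrN1.
have sh_le (j : J) (x : 'cV[int]_d.+1) : (forall i, `|(x i 0)%R| <= 1)%N ->
    (`|sh j x|%N <= orbit_scale X G 1 * shift_scale X)%N.
  move=> x_le; rewrite -[leqRHS]muln1 -[X in (_ <= _ * X)%N](expn0 (map_growth X ^ 2)).
  by apply: shift_orbit_bound => // n; apply: orbit_val_bound.
have delta_le (i k : 'I_d.+1) : (`|((delta_mx i 0 : 'cV[int]_d.+1) k 0)%R| <= 1)%N.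
  by rewrite mxE; case: (_ && _).
have zero_le (k : 'I_d.+1) : (`|((0 : 'cV[int]_d.+1) k 0)%R| <= 1)%N by rewrite mxE.
have card_J : (#|J| <= X * 2 * X.+1)%N.
  rewrite !card_prod card_bool card_ord leq_mul // ?leq_mul2r ?le_RX ?orbT //.
  exact: leq_trans (size_pos_roots A) _.
have [|||j i|j|c' [c'_le c'_sgn]] := @small_sign_solution J d.+1 (X * 2 * X.+1)
    (system_size X G) L (fun j => sh j 0) (fun i => c i 0).
- exact: card_J.
- by [].
- by rewrite /system_size; lia.
- have := sh_le j _ (delta_le i); have := sh_le j _ zero_le.
  by rewrite /L /system_size; lia.
- by have := sh_le j _ zero_le; rewrite /system_size; lia.
have bound_c' i : (`|((\col_k c' k) i 0)%R| <= solution_bound X G)%N by rewrite mxE.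
exists (\col_i c' i) => // le_Y r p.
rewrite (@orbit_val_sign _ _ _ _ _ G Y) // => [|i]; last exact: leq_trans le_Y.
rewrite -[X in _ == X](lead_c r p); apply/eqP; apply: eq_lead_sgn => i lt_i.
pose j : J := (r, p, Ordinal lt_i); have := c'_sgn j; rewrite (sh_affine j c).
rewrite -/(sh j c) -/(sh j (\col_i c' i)) => <-; rewrite -sh_affine.
by congr (sgz (_ + _)); apply: eq_bigr => k _; rewrite mxE.
Qed.

(** * Sizes of codes *)

Lemma getc_le m i : (getc m i <= m)%N.
Proof.
rewrite /getc; case: (ltnP i (size (CodeSeq.decode m))) => [lti | lei].
  have := allP (CodeSeq.ltn_code (CodeSeq.decode m)) _ (mem_nth 0%N lti).
  by rewrite CodeSeq.decodeK => /ltnW.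
by rewrite nth_default.
Qed.

Lemma size_le_code s : (size s <= CodeSeq.code s)%N.
Proof.
elim: s => //= a s IHs; have : (0 < 2 ^ a)%N by rewrite expn_gt0.
by nia.
Qed.

Lemma code_lt (s : seq nat) (n M : nat) : (size s <= n)%N ->
  (forall i, (nth 0 s i <= M)%N) -> (CodeSeq.code s < 2 ^ (n * M.+1))%N.
Proof.
elim: s n => [|a s IHs] n /=; first by rewrite expn_gt0.
case: n => // n; rewrite ltnS => size_s s_le.
have := IHs n size_s (fun i => s_le i.+1); have := s_le 0%N => /= a_le code_s.
rewrite mulSn expnD.
have : (2 ^ a.+1 <= 2 ^ M.+1)%N by rewrite leq_pexp2l.
rewrite expnS; have : (0 < 2 ^ a)%N by rewrite expn_gt0.
by move: code_s; move: (2 ^ a)%N (2 ^ M.+1)%N (2 ^ (n * _))%N => x y z; nia.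
Qed.

Lemma absz_encode_int z : (`|z| <= encode_int z <= `|z|.*2)%N.
Proof. by case: z => n /=; lia. Qed.

Lemma absz_dec_int m : (`|dec_int m| <= m)%N.
Proof. by rewrite -{2}(dec_intK m); case/andP: (absz_encode_int (dec_int m)). Qed.

(** * The decision procedure *)

Definition col_of_code (d y : nat) : 'cV[int]_d := \col_i dec_int (getc y i).

Definition code_step (X y : nat) : nat :=
  CodeSeq.code (mkseq (fun i => encode_int
    (\sum_(j < getc X 0) dec_int (getc (getc (getc X 1) i) j) * dec_int (getc y j)
     + dec_int (getc (getc X 2) i))) (getc X 0)).

(* X`! is a common multiple of all denominators occurring in the loop with code X;
   the denominator is the positive integer encoded by getc q 1. *)
Definition cleared_coef (X q : nat) : int :=
  dec_int (getc q 0) * (X`! %/ (getc q 1 %/ 2))%:Z.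

(** The number of inequalities is not stored, so [k] runs up to [X]. The entry 0 marks an index past
    the end: the code of an inequality is that of a non-empty list, hence positive. *)
Definition code_guard (X y : nat) : bool :=
  [forall k : 'I_X, (getc (getc X 3) k == 0%N) ||
    (0 < \sum_(j < getc X 0) cleared_coef X (getc (getc (getc (getc X 3) k) 0) j)
                             * dec_int (getc y j)
         + cleared_coef X (getc (getc (getc X 3) k) 1))].

Definition coef_bound (X : nat) : nat := (X * X`!)%N.

(** This is the bound of [code_lt] for at most [X] entries; an integer of absolute value at most [T]
    has code at most [T * 2]. *)
Definition code_bound (X : nat) : nat :=
  (2 ^ (X * ((solution_bound X (coef_bound X)) * 2).+1))%N.

(** The decision time is taken for entries up to [code_bound X], since every [y] below that bound is
    tested and may decode to entries larger than [solution_bound]. *)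
Definition check_time (X : nat) : nat :=
  ((decision_time X (coef_bound X) (code_bound X) + X) * 2)%N.

Definition code_nonterminating (X : nat) : bool :=
  [exists y : 'I_(code_bound X),
     code_guard X (iter (check_time X) (code_step X) y)
     && code_guard X (iter (check_time X).+1 (code_step X) y)].

Lemma nth_enum_map (d : nat) (f : 'I_d -> nat) (j : 'I_d) :
  nth 0%N [seq f i | i <- enum 'I_d] j = f j.
Proof. by rewrite (nth_map j) ?size_enum_ord // nth_ord_enum. Qed.

Lemma getc_encode_mx d (A : 'M[int]_d) (i j : 'I_d) :
  dec_int (getc (getc (encode_mx encode_int A) i) j) = A i j.
Proof. by rewrite !getc_code nth_enum_map getc_code nth_enum_map encode_intK. Qed.

Lemma getc_encode_cv (T : Type) (enc : T -> nat) d (v : 'cV[T]_d) (i : 'I_d) :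
  getc (encode_cv enc v) i = enc (v i 0).
Proof. by rewrite getc_code nth_enum_map. Qed.

Lemma cleared_coefE (X : nat) (q : rat) : (encode_int (denq q) <= X)%N ->
  (cleared_coef X (encode_rat q))%:~R = (X`!)%:R * q.
Proof.
move=> den_le; rewrite /cleared_coef !getc_code /= encode_intK.
have /andP[den_le' _] := absz_encode_int (denq q).
set m := `|denq q|%N.
have -> : (encode_int (denq q) %/ 2)%N = m.
  by rewrite /m; case: (denq q) (denq_gt0 q) => //= n _; rewrite divn2 doubleK.
have m_gt0 : (0 < m)%N by rewrite absz_gt0 denq_neq0.
have m_dvd : (m %| X`!)%N by rewrite dvdn_fact // m_gt0 (leq_trans den_le').
have eq_den : denq q = m%:Z by rewrite /m absz_denq.
rewrite -[in RHS](divnK m_dvd) -[in RHS](divq_num_den q) eq_den natrM rmorphM /=.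
rewrite -!pmulrn; field.
by rewrite pnatr_eq0 -lt0n.
Qed.

(** * Computability of the procedure *)

Ltac computability :=
  repeat first [ assumption
    | exact: computable_var0 | exact: computable_var1 | exact: computable_const
    | apply: computable_behead2; assumption
    | apply: computable_behead; assumption
    | apply: computable_getc | apply: computable_dec_int | apply: computable_int_nat
    | apply: computable_int_add | apply: computable_int_mul
    | apply: computable_add | apply: computable_mul | apply: computable_exp
    | apply: computable_double | apply: computable_divn | apply: computable_fact
    | apply: computable_succ | apply: computable_sub ].

Lemma computable_code_step k f g : computable k f -> computable k g ->
  computable k (fun s => code_step (f s) (g s)).
Proof.
move=> f_rec g_rec; apply: (computable_mkseq (F := fun s i => encode_int
  (\sum_(j < getc (f s) 0)
     dec_int (getc (getc (getc (f s) 1) i) j) * dec_int (getc (g s) j)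
   + dec_int (getc (getc (f s) 2) i)))); first by computability.
apply/computable_encode_int/computable_int_add; last by computability.
apply: (computable_int_sum (F := fun s j =>
  dec_int (getc (getc (getc (f (behead s)) 1) (head 0%N s)) j)
    * dec_int (getc (g (behead s)) j))); by computability.
Qed.

Lemma computable_cleared_coef k f g : computable k f -> computable k g ->
  computable_int k (fun s => cleared_coef (f s) (g s)).
Proof. by move=> f_rec g_rec; rewrite /cleared_coef; computability. Qed.

Lemma computable_code_guard k f g : computable k f -> computable k g ->
  computable_pred k (fun s => code_guard (f s) (g s)).
Proof.
move=> f_rec g_rec.
apply: (computable_forall (p := fun s i => (getc (getc (f s) 3) i == 0%N) ||
    (0 < \sum_(j < getc (f s) 0)
       cleared_coef (f s) (getc (getc (getc (getc (f s) 3) i) 0) j) * dec_int (getc (g s) j)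
     + cleared_coef (f s) (getc (getc (getc (f s) 3) i) 1)))) => //.
apply: computable_or; first by apply: computable_eqn; computability.
apply/computable_int_gt0/computable_int_add; last first.
  by apply: computable_cleared_coef; computability.
apply: (computable_int_sum (F := fun s j =>
   cleared_coef (f (behead s)) (getc (getc (getc (getc (f (behead s)) 3) (head 0%N s)) 0) j)
   * dec_int (getc (g (behead s)) j))); first by computability.
apply: computable_int_mul; last by computability.
by apply: computable_cleared_coef; computability.
Qed.

Lemma computable_sol_growth k f :
  computable k f -> computable k (fun s => sol_growth (f s)).
Proof. by move=> f_rec; rewrite /sol_growth; computability. Qed.

Lemma computable_orbit_scale k f g h :
  computable k f -> computable k g -> computable k h ->
  computable k (fun s => orbit_scale (f s) (g s) (h s)).
Proof. by move=> f_rec g_rec h_rec; rewrite /orbit_scale /map_growth; computability. Qed.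

Lemma computable_shift_scale k f :
  computable k f -> computable k (fun s => shift_scale (f s)).
Proof.
by move=> f_rec; rewrite /shift_scale /map_growth /root_bound; computability.
Qed.

Lemma computable_coef_bound k f :
  computable k f -> computable k (fun s => coef_bound (f s)).
Proof. by move=> f_rec; rewrite /coef_bound; computability. Qed.

Lemma computable_solution_bound k f g : computable k f -> computable k g ->
  computable k (fun s => solution_bound (f s) (g s)).
Proof.
move=> f_rec g_rec.
apply: (computable_iter (step := fun=> sol_growth)); last first.
- exact: computable_sol_growth (computable_var0 _).
- have := computable_orbit_scale f_rec g_rec (computable_const k 1).
  by have := computable_shift_scale f_rec; rewrite /system_size => *; computability.
by computability.
Qed.

Lemma computable_decision_time k f g h :
  computable k f -> computable k g -> computable k h ->
  computable k (fun s => decision_time (f s) (g s) (h s)).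
Proof.
move=> f_rec g_rec h_rec.
have o_rec := computable_orbit_scale f_rec g_rec h_rec.
have sh_rec := computable_shift_scale f_rec.
have H_rec : computable k (fun s => root_bound (f s) ^ (f s).+1
    * (orbit_scale (f s) (g s) (h s) * shift_scale (f s)))%N.
  by rewrite /root_bound; computability.
have q_rec : computable k (fun s => map_growth (f s) ^ 2)%N.
  by rewrite /map_growth; computability.
pose H s := (root_bound (f s) ^ (f s).+1
  * (orbit_scale (f s) (g s) (h s) * shift_scale (f s)))%N.
apply: (computable_iter (step := fun s t =>
  (t + H s * (map_growth (f s) ^ 2) ^ t).+1)); by computability.
Qed.

Lemma computable_code_bound k f :
  computable k f -> computable k (fun s => code_bound (f s)).
Proof.
move=> f_rec; have := computable_solution_bound f_rec (computable_coef_bound f_rec).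
by rewrite /code_bound => ?; computability.
Qed.

Lemma computable_check_time k f :
  computable k f -> computable k (fun s => check_time (f s)).
Proof.
move=> f_rec; have := computable_decision_time f_rec (computable_coef_bound f_rec)
  (computable_code_bound f_rec).
by rewrite /check_time => ?; computability.
Qed.

Lemma computable_iter_code_step k f g h :
  computable k f -> computable k g -> computable k h ->
  computable k (fun s => iter (h s) (code_step (f s)) (g s)).
Proof.
move=> f_rec g_rec h_rec.
apply: (computable_iter (step := fun s => code_step (f s))) => //.
by apply: computable_code_step; computability.
Qed.

Lemma computable_code_nonterminating k f :
  computable k f -> computable_pred k (fun s => code_nonterminating (f s)).
Proof.
move=> f_rec; have n_rec := computable_check_time f_rec.
apply: (computable_exists (n := fun s => code_bound (f s)) (p := fun s y =>
     code_guard (f s) (iter (check_time (f s)) (code_step (f s)) y)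
     && code_guard (f s) (iter (check_time (f s)).+1 (code_step (f s)) y))).
  exact: computable_code_bound.
have f_rec' := computable_behead f_rec; have n_rec' := computable_behead n_rec.
by apply: computable_and; apply: computable_code_guard => //;
  apply: computable_iter_code_step => //; computability.
Qed.

(** * Correctness of the procedure *)

Lemma col_of_code_step (L : affine_loop) y :
  col_of_code (dim L) (code_step (encode_loop L) y) = update (col_of_code (dim L) y).
Proof.
apply/matrixP => i j; rewrite (ord1 j) {j} /update !mxE /code_step !getc_code /=.
rewrite nth_mkseq // encode_intK getc_encode_cv encode_intK; congr (_ + _).
by apply: eq_bigr => k _; rewrite getc_encode_mx mxE.
Qed.

Lemma col_of_code_iter (L : affine_loop) n y :
  col_of_code (dim L) (iter n (code_step (encode_loop L)) y) =
  iter n (@update L) (col_of_code (dim L) y).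
Proof. by elim: n => //= n IHn; rewrite col_of_code_step IHn. Qed.

Definition cleared_atom (L : affine_loop) (alpha : 'cV[rat]_(dim L) * rat) :
    'rV[int]_(dim L) * int :=
  let X := encode_loop L in
  (\row_j cleared_coef X (encode_rat (alpha.1 j 0)), cleared_coef X (encode_rat alpha.2)).

Lemma encode_atom_le (L : affine_loop) alpha :
  alpha \in guard L -> (encode_atom alpha <= encode_loop L)%N.
Proof.
move=> alpha_in; pose k := index alpha (guard L).
have <- : getc (getc (encode_loop L) 3) k = encode_atom alpha.
  by rewrite !getc_code (nth_map alpha) ?index_mem // nth_index.
by rewrite (leq_trans (getc_le _ _)) // getc_le.
Qed.

Lemma encode_rat_le (L : affine_loop) alpha : alpha \in guard L ->
  (forall j, (encode_rat (alpha.1 j 0)%R <= encode_loop L)%N) /\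
  (encode_rat alpha.2 <= encode_loop L)%N.
Proof.
move=> /encode_atom_le le_L; split=> [j|]; apply: leq_trans le_L.
  rewrite -(getc_encode_cv encode_rat) (leq_trans (getc_le _ _)) //.
  by have := getc_le (encode_atom alpha) 0; rewrite getc_code.
by have := getc_le (encode_atom alpha) 1; rewrite getc_code.
Qed.

Lemma encode_denq_le q X : (encode_rat q <= X)%N -> (encode_int (denq q) <= X)%N.
Proof.
by apply: leq_trans; have := getc_le (encode_rat q) 1; rewrite getc_code.
Qed.

Lemma cleared_atomE (L : affine_loop) alpha x : alpha \in guard L ->
  (0 < atom_val (cleared_atom alpha) x) =
  (0 < (alpha.1^T *m map_mx (intr : int -> rat) x) 0 0 + alpha.2).
Proof.
move=> /encode_rat_le [le1 le2]; set X := encode_loop L in le1 le2.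
have X_gt0 : 0 < (X`!)%:R :> rat by rewrite ltr0n fact_gt0.
rewrite -(ltr0z rat) -[RHS](pmulr_rgt0 _ X_gt0); congr (0 < _).
rewrite /atom_val rmorphD /= cleared_coefE ?encode_denq_le // mulrDr; congr (_ + _).
rewrite !mxE rmorph_sum mulr_sumr; apply: eq_bigr => j _.
by rewrite !mxE rmorphM /= cleared_coefE ?encode_denq_le // mulrA.
Qed.

Lemma absz_cleared_coef X q : (q <= X)%N -> (`|cleared_coef X q| <= coef_bound X)%N.
Proof.
move=> le_q; rewrite abszM leq_mul //=; last exact: leq_div.
by rewrite (leq_trans (absz_dec_int _)) // (leq_trans (getc_le _ _)).
Qed.

Lemma code_guardP (L : affine_loop) y :
  reflect (guard_holds (col_of_code (dim L) y)) (code_guard (encode_loop L) y).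
Proof.
set X := encode_loop L; pose n := size (guard L).
have atomE k alpha : (k < n)%N -> nth alpha (guard L) k = alpha ->
    getc (getc X 3) k = encode_atom alpha.
  by move=> lt_k eq_k; rewrite !getc_code (nth_map alpha) // eq_k.
have valE alpha : \sum_(j < getc X 0) cleared_coef X (getc (getc (encode_atom alpha) 0) j)
                             * dec_int (getc y j)
      + cleared_coef X (getc (encode_atom alpha) 1)
    = atom_val (cleared_atom alpha) (col_of_code (dim L) y).
  rewrite !getc_code /= /atom_val; congr (_ + _).
  by rewrite mxE; apply: eq_bigr => j _; rewrite getc_encode_cv !mxE.
have le_nX : (n <= X)%N.
  have := size_le_code [seq encode_atom alpha | alpha <- guard L]; rewrite size_map.
  by move/leq_trans; apply; have := getc_le X 3; rewrite getc_code.
apply: (iffP forallP) => [guard_y alpha alpha_in | guard_y k].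
  have lt_k : (index alpha (guard L) < n)%N by rewrite index_mem.
  rewrite -cleared_atomE //.
  have := guard_y (Ordinal (leq_trans lt_k le_nX)).
  rewrite (atomE _ alpha) ?nth_index // valE.
  by rewrite /encode_atom /= muln_eq0 expn_eq0.
case: (ltnP k n) => [lt_k|le_k]; last first.
  by rewrite !getc_code [nth _ (map _ _) _]nth_default ?size_map.
have [alpha eq_alpha] : exists alpha, nth alpha (guard L) k = alpha.
  exists (nth (0, 0) (guard L) k); exact: set_nth_default.
rewrite (atomE _ alpha) // valE cleared_atomE ?guard_y ?orbT //.
  by rewrite -eq_alpha mem_nth.
by rewrite -eq_alpha mem_nth.
Qed.

Lemma code_nonterminatingP (L : affine_loop) :
  triangular_loop L -> nonterminating L <-> code_nonterminating (encode_loop L).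
Proof.
case: L => [[|d] A a phi] [//] /= _ tri_A.
set L := AffineLoop A a phi; set X := encode_loop L.
pose g (r : 'I_(size phi)) := cleared_atom (L := L) (tnth (in_tuple phi) r).
have guardE x : (forall r, 0 < atom_val (g r) x) <-> guard_holds (L := L) x.
  split=> [pos alpha alpha_in | guard_x r]; last first.
    by rewrite cleared_atomE ?mem_tnth //; apply: guard_x; apply: mem_tnth.
  rewrite -cleared_atomE //; have lt_i : (index alpha phi < size phi)%N by rewrite index_mem.
  by have := pos (Ordinal lt_i); rewrite /g (tnth_nth alpha) /= nth_index.
have le_dX : (d.+1 <= X)%N by have := getc_le X 0; rewrite getc_code.
have le_phiX : (#|'I_(size phi)| <= X)%N.
  rewrite card_ord -(size_map (@encode_atom d.+1)) (leq_trans (size_le_code _)) //.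
  by have := getc_le X 3; rewrite getc_code.
have A_le i j : (`|(A i j)%R| <= X)%N.
  rewrite -(getc_encode_mx A) (leq_trans (absz_dec_int _)) //.
  rewrite (leq_trans (getc_le _ _)) // (leq_trans (getc_le _ _)) //.
  by have := getc_le X 1; rewrite getc_code.
have a_le i : (`|(a i 0)%R| <= X)%N.
  case/andP: (absz_encode_int (a i 0)) => + _; move/leq_trans; apply.
  rewrite -(getc_encode_cv encode_int) (leq_trans (getc_le _ _)) //.
  by have := getc_le X 2; rewrite getc_code.
have g_le r j : (`|((g r).1 0 j)%R| <= coef_bound X)%N.
  rewrite mxE absz_cleared_coef //.
  by case: (encode_rat_le (L := L) (mem_tnth r (in_tuple phi))).
have g0_le r : (`|(g r).2| <= coef_bound X)%N.
  rewrite absz_cleared_coef //.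
  by case: (encode_rat_le (L := L) (mem_tnth r (in_tuple phi))).
have [bounded nonterm] := nonterminating_bounded (code_bound X) tri_A le_dX le_phiX
  A_le a_le g_le g0_le.
set T := solution_bound X (coef_bound X) in bounded.
set N := decision_time X (coef_bound X) (code_bound X) in bounded nonterm.
have guard_code n y : code_guard X (iter n (code_step X) y) <->
    forall r, 0 < atom_val (g r) (iter n (affine_map A a) (col_of_code d.+1 y)).
  by rewrite guardE -(col_of_code_iter L); apply: iff_sym; apply: rwP (code_guardP _ _).
have time_eq (p : bool) : ((N + X).*2 + p = check_time X + p)%N by rewrite -muln2.
have guard_time y : (code_guard X (iter (check_time X) (code_step X) y)
      && code_guard X (iter (check_time X).+1 (code_step X) y)) <->
    forall r (p : bool), 0 < orbit_val A a X p (g r) (col_of_code d.+1 y) N.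
  split=> [/andP[/guard_code pos0 /guard_code pos1] r [] | pos].
  - by rewrite /orbit_val time_eq addn1.
  - by rewrite /orbit_val time_eq addn0.
  apply/andP; split; apply/guard_code => r.
    by have := pos r false; rewrite /orbit_val time_eq addn0.
  by have := pos r true; rewrite /orbit_val time_eq addn1.
split=> [[c c_pos] | /existsP[y /guard_time pos]]; last first.
  have [j|c c_pos] := nonterm (col_of_code d.+1 y) _ pos.
    rewrite mxE (leq_trans (absz_dec_int _)) // (leq_trans (getc_le _ _)) //.
    exact: ltnW.
  by exists c => n; apply/guardE/c_pos.
have [n r|c' c'_le c'_pos] := bounded c.
  by move: r; apply/guardE/c_pos.
pose y := encode_cv encode_int c'.
have y_lt : (y < code_bound X)%N.
  apply: code_lt => [|i]; first by rewrite size_map size_enum_ord.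
  case: (ltnP i d.+1) => [lt_i|le_i]; last first.
    by rewrite nth_default // size_map size_enum_ord.
  rewrite (nth_enum_map _ (Ordinal lt_i)).
  case/andP: (absz_encode_int (c' (Ordinal lt_i) 0)) => _ /leq_trans; apply.
  by rewrite muln2 leq_double.
have y_eq : col_of_code d.+1 y = c'.
  by apply/matrixP => i j; rewrite (ord1 j) mxE getc_encode_cv encode_intK.
apply/existsP; exists (Ordinal y_lt); apply/guard_time; rewrite y_eq; apply: c'_pos.
(* [T < 2 ^ T], and the exponent in [code_bound X] is at least [T] because [X] is positive. *)
rewrite /code_bound -/T (leq_trans (ltnW (ltn_expl T (isT : 1 < 2)%N))) //.
by rewrite leq_pexp2l // muln2; nia.
Qed.

Theorem theorem3 :
  computably_decidable encode_loop triangular_loop terminates.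
Proof.
exists (fun v => ~~ code_nonterminating (head 0%N v) : nat); split.
  exact: computable_neg (computable_code_nonterminating (computable_var0 1)).
move=> L tri_L; have nontermP := code_nonterminatingP tri_L.
split=> /= [term|nterm].
  by case: (boolP (code_nonterminating _)) => // /nontermP/term.
by case: (boolP (code_nonterminating _)) => // /negP code; case: nterm => /nontermP.
Qed.
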